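(* For each integer $n\ge2$, let $\mathrm{Mod}(\mathbb{P}_{n+1})\cong G_{n+1}=B_{n+1}/Z(B_{n+1})$ be the mapping class group of the $(n+1)$-times punctured plane. Then the trivial $\mathbb{Z}G_{n+1}$-module $\mathbb{Z}$ has a finite type free resolution over $\mathbb{Z}G_{n+1}$ that is $2$-periodic in degrees $\ge n$. Furthermore, the stable rank in the $2$-periodic part is $2^{n-1}$, i.e. the free modules in the $2$-periodic part all have rank $2^{n-1}$.
   Context: $B_{n+1}$ is the braid group on $n+1$ strands, with generators $\sigma_1,\dots,\sigma_n$ and relations $\sigma_i\sigma_{i+1}\sigma_i=\sigma_{i+1}\sigma_i\sigma_{i+1}$ for $1\le i\le n-1$ and $\sigma_i\sigma_j=\sigma_j\sigma_i$ for $|i-j|\ge2$. Its center is infinite cyclic, generated by the full twist $\Delta_{n+1}=(\sigma_1\sigma_2\cdots\sigma_n)^{n+1}$, and $G_{n+1}=B_{n+1}/\langle\Delta_{n+1}\rangle$ is isomorphic to the group $\mathrm{Mod}(\mathbb{P}_{n+1})$ of isotopy classes of orientation-preserving homeomorphisms of the plane with $n+1$ punctures (possibly permuting the punctures). A resolution is finite type if each of its terms is finitely generated. A resolution $(M_j,\partial_j:M_j\to M_{j-1})_{j\ge 0}$ is $2$-periodic in degrees $\ge m$ if $M_{j+2}=M_j$ for all $j\ge m$ and $\partial_{j+2}=\partial_j$ for all $j\ge m+1$. *)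

(* Defs.v *)
From HB Require Import structures.
From mathcomp Require Import all_boot all_order all_fingroup all_algebra.
From mathcomp Require Import generic_quotient finmap.
From mathcomp Require Import boolp.
From mathcomp.multinomials Require Import monalg.

Set Implicit Arguments.
Unset Strict Implicit.
Unset Printing Implicit Defensive.

Import GRing.Theory.
Local Open Scope ring_scope.
Local Open Scope quotient_scope.

Section BraidGroup.
Variable m : nat.

(* The letter (i, b), with i : 'I_m.-1 counted from 0, stands for the generator
   sigma_(i+1) of the braid group on m strands if b = true, and for its inverse
   if b = false. *)
Definition braid_word : Type := seq ('I_m.-1 * bool).
HB.instance Definition _ := Choice.on braid_word.

Inductive braid_equiv : braid_word -> braid_word -> Prop :=
| BraidRefl u : braid_equiv u u
| BraidSym u v : braid_equiv u v -> braid_equiv v u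
| BraidTrans u v w : braid_equiv u v -> braid_equiv v w -> braid_equiv u w
| BraidCat u u' v v' :
    braid_equiv u u' -> braid_equiv v v' -> braid_equiv (u ++ v) (u' ++ v')
| BraidCancel i b : braid_equiv [:: (i, b); (i, ~~ b)] [::]
| BraidBraid (i j : 'I_m.-1) : j = i.+1 :> nat ->
    braid_equiv [:: (i, true); (j, true); (i, true)]
                [:: (j, true); (i, true); (j, true)]
| BraidComm (i j : 'I_m.-1) : (i.+2 <= j)%N || (j.+2 <= i)%N ->
    braid_equiv [:: (i, true); (j, true)] [:: (j, true); (i, true)].

(* Made boolean, by classical logic, so that the quotient can be formed. *)
Definition braid_rel : rel braid_word := [rel u v | `[< braid_equiv u v >]].

Lemma braid_rel_refl : reflexive braid_rel.
Proof. by move=> u; apply/asboolP/BraidRefl. Qed.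

Lemma braid_rel_sym : symmetric braid_rel.
Proof. by move=> u v; apply/asboolP/asboolP; apply: BraidSym. Qed.

Lemma braid_rel_trans : transitive braid_rel.
Proof.
by move=> v u w /asboolP uv /asboolP vw; apply/asboolP/(BraidTrans uv vw).
Qed.

Canonical braid_rel_equiv :=
  EquivRel braid_rel braid_rel_refl braid_rel_sym braid_rel_trans.

Definition braid : Type := {eq_quot braid_rel}.
HB.instance Definition _ := Choice.on braid.
HB.instance Definition _ := EqQuotient.on braid.

Lemma eq_braidP u v : reflect (\pi_braid u = \pi_braid v) (braid_rel u v).
Proof. by rewrite -eqmodE; exact: eqP. Qed.

Lemma repr_braid u : braid_equiv (repr (\pi_braid u)) u.
Proof. by apply/asboolP; apply/eq_braidP; rewrite reprK. Qed.

Definition braid_word_inv (u : braid_word) : braid_word :=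
  rev [seq (a.1, ~~ a.2) | a <- u].

Definition braid_one : braid := \pi_braid [::].
Definition braid_mul (x y : braid) : braid := \pi_braid (repr x ++ repr y).
Definition braid_inv (x : braid) : braid := \pi_braid (braid_word_inv (repr x)).

Lemma braid_mulE u v : braid_mul (\pi u) (\pi v) = \pi_braid (u ++ v).
Proof. by apply/eq_braidP/asboolP/BraidCat; exact: repr_braid. Qed.

Lemma braid_mulA : associative braid_mul.
Proof.
by move=> x y z; rewrite -[x]reprK -[y]reprK -[z]reprK !braid_mulE catA.
Qed.

Lemma braid_1mul : left_id braid_one braid_mul.
Proof. by move=> x; rewrite -[x]reprK braid_mulE. Qed.

Lemma braid_mul1 : right_id braid_one braid_mul.
Proof. by move=> x; rewrite -[x]reprK braid_mulE cats0. Qed.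

Lemma braid_word_invK : involutive braid_word_inv.
Proof.
move=> u; rewrite /braid_word_inv map_rev revK -map_comp -[RHS]map_id.
by apply: eq_map => -[i b] /=; rewrite negbK.
Qed.

Lemma braid_word_mulV u : braid_equiv (u ++ braid_word_inv u) [::].
Proof.
elim: u => [|[i b] u IHu]; first exact: BraidRefl.
rewrite /braid_word_inv map_cons rev_cons -cats1 -cat1s -catA (catA u).
apply: BraidTrans (BraidCancel i b); rewrite -[[:: (i, b); _]]cat1s.
apply: BraidCat (BraidRefl _) _.
by rewrite -[X in braid_equiv _ X]cat0s; apply: BraidCat (BraidRefl _).
Qed.

Lemma braid_mulV : right_inverse braid_one braid_inv braid_mul.
Proof.
move=> x; rewrite /braid_inv -{1}[x]reprK braid_mulE.
exact/eq_braidP/asboolP/braid_word_mulV.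
Qed.

Lemma braid_Vmul : left_inverse braid_one braid_inv braid_mul.
Proof.
move=> x; rewrite /braid_inv -{2}[x]reprK braid_mulE.
apply/eq_braidP/asboolP; rewrite -{2}[repr x]braid_word_invK.
exact: braid_word_mulV.
Qed.

HB.instance Definition _ := isGroup.Build braid
  braid_mulA braid_1mul braid_mul1 braid_Vmul braid_mulV.

End BraidGroup.

Section CentralQuotient.
Variable G : groupType.

Definition central : pred G := fun z => `[< forall x : G, (x * z = z * x)%g >].

Lemma centralP z : reflect (forall x : G, (x * z = z * x)%g) (central z).
Proof. exact: asboolP. Qed.

Definition center_rel : rel G := [rel x y | central (x^-1 * y)%g].

Lemma central1 : central 1%g.
Proof. by apply/centralP => x; rewrite mul1g mulg1. Qed.

Lemma centralM x y : central x -> central y -> central (x * y)%g.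
Proof.
move=> /centralP cx /centralP cy; apply/centralP => z.
by rewrite (mulgA z) (cx z) -(mulgA x z) (cy z) mulgA.
Qed.

Lemma centralV x : central x -> central x^-1%g.
Proof.
move=> /centralP cx; apply/centralP => z.
by apply: (mulgI x); rewrite mulKVg mulgA -cx mulgK.
Qed.

Lemma center_rel_refl : reflexive center_rel.
Proof. by move=> x; rewrite -[center_rel x x]/(central (x^-1 * x)%g) mulVg central1. Qed.

Lemma center_rel_sym : symmetric center_rel.
Proof.
suff H x y : center_rel x y -> center_rel y x
  by move=> x y; apply/idP/idP; exact: H.
by move=> /centralV; rewrite invMg invgK.
Qed.

Lemma center_rel_trans : transitive center_rel.
Proof.
move=> y x z cxy cyz; rewrite -[center_rel x z]/(central (x^-1 * z)%g).
by rewrite -(mulgK y x^-1%g) -mulgA centralM.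
Qed.

Canonical center_rel_equiv :=
  EquivRel center_rel center_rel_refl center_rel_sym center_rel_trans.

Definition mod_center : Type := {eq_quot center_rel}.
HB.instance Definition _ := Choice.on mod_center.
HB.instance Definition _ := EqQuotient.on mod_center.

Lemma eq_mod_centerP x y :
  reflect (\pi_mod_center x = \pi_mod_center y) (central (x^-1 * y)%g).
Proof. by rewrite -[central _]/(center_rel x y) -eqmodE; exact: eqP. Qed.

Lemma repr_mod_center x : central ((repr (\pi_mod_center x))^-1 * x)%g.
Proof. by apply/eq_mod_centerP; rewrite reprK. Qed.

Definition mod_center_one : mod_center := \pi_mod_center 1%g.
Definition mod_center_mul (x y : mod_center) : mod_center :=
  \pi_mod_center (repr x * repr y)%g.
Definition mod_center_inv (x : mod_center) : mod_center :=
  \pi_mod_center (repr x)^-1%g.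

Lemma mod_center_mulE x y :
  mod_center_mul (\pi x) (\pi y) = \pi_mod_center (x * y)%g.
Proof.
rewrite /mod_center_mul; apply/eq_mod_centerP.
move: (repr_mod_center x) (repr_mod_center y).
set x' := repr (\pi x); set y' := repr (\pi y) => cx cy.
suff -> : ((x' * y')^-1 * (x * y) = (x'^-1 * x) * (y'^-1 * y))%g by exact: centralM.
by rewrite invMg -mulgA (mulgA x'^-1%g) (mulgA y'^-1%g) (centralP _ cx) -mulgA.
Qed.

Lemma mod_center_mulA : associative mod_center_mul.
Proof.
by move=> x y z; rewrite -[x]reprK -[y]reprK -[z]reprK !mod_center_mulE mulgA.
Qed.

Lemma mod_center_1mul : left_id mod_center_one mod_center_mul.
Proof. by move=> x; rewrite -[x]reprK mod_center_mulE mul1g. Qed.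

Lemma mod_center_mul1 : right_id mod_center_one mod_center_mul.
Proof. by move=> x; rewrite -[x]reprK mod_center_mulE mulg1. Qed.

Lemma mod_center_Vmul : left_inverse mod_center_one mod_center_inv mod_center_mul.
Proof.
by move=> x; rewrite /mod_center_inv -{2}[x]reprK mod_center_mulE mulVg.
Qed.

Lemma mod_center_mulV : right_inverse mod_center_one mod_center_inv mod_center_mul.
Proof.
by move=> x; rewrite /mod_center_inv -{1}[x]reprK mod_center_mulE mulgV.
Qed.

HB.instance Definition _ := isGroup.Build mod_center mod_center_mulA
  mod_center_1mul mod_center_mul1 mod_center_Vmul mod_center_mulV.

End CentralQuotient.

(* The additive group int, to be made a module over the integral group ring of G
   on which every element of G acts as the identity. *)
Definition trivial_module (G : groupType) : Type := int.
HB.instance Definition _ (G : groupType) := GRing.Zmodule.on (trivial_module G).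

Section GroupRing.
Variable G : groupType.

(* {malg int[G]} is the additive group of finitely supported functions G -> int;
   << c *g x >> is c times the group element x.  The ring structure that monalg
   puts on it needs a monoid without nontrivial units, hence the one below. *)
Definition group_ring : Type := {malg int[G]}.
HB.instance Definition _ := GRing.Zmodule.on group_ring.

Implicit Types a b c : group_ring.

Definition group_ring_one : group_ring := << 1%g >>.
Definition group_ring_mul a b : group_ring :=
  \sum_(x <- msupp a) \sum_(y <- msupp b) << a@_x * b@_y *g (x * y)%g >>.

Local Notation "a *G b" := (group_ring_mul a b) (at level 40).

Lemma group_ring_mulw (d e : {fset G}) a b :
  fsubset (msupp a) d -> fsubset (msupp b) e ->
  a *G b = \sum_(x <- d) \sum_(y <- e) << a@_x * b@_y *g (x * y)%g >>.
Proof.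
move=> le_d le_e; rewrite /group_ring_mul (big_fset_incl _ le_d) /=.
  apply/eq_bigr => x _; apply/big_fset_incl => // y _ /mcoeff_outdom ->.
  by rewrite mulr0 monalgU0.
move=> x _ /mcoeff_outdom ax.
by rewrite big1 // => y _; rewrite ax mul0r monalgU0.
Qed.

Lemma group_ring_mulDl : left_distributive group_ring_mul +%R.
Proof.
move=> a b c.
rewrite (group_ring_mulw (fsubsetUl (msupp a) (msupp b)) (fsubset_refl (msupp c))).
rewrite (group_ring_mulw (fsubsetUr (msupp a) (msupp b)) (fsubset_refl (msupp c))).
rewrite (group_ring_mulw (msuppD_le _ _) (fsubset_refl (msupp c))).
rewrite -big_split /=; apply/eq_bigr => x _.
rewrite -big_split /=; apply/eq_bigr => y _.
by rewrite mcoeffD mulrDl monalgUD.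
Qed.

Lemma group_ring_mulDr : right_distributive group_ring_mul +%R.
Proof.
move=> a b c.
rewrite (group_ring_mulw (fsubset_refl (msupp a)) (fsubsetUl (msupp b) (msupp c))).
rewrite (group_ring_mulw (fsubset_refl (msupp a)) (fsubsetUr (msupp b) (msupp c))).
rewrite (group_ring_mulw (fsubset_refl (msupp a)) (msuppD_le _ _)).
rewrite -big_split /=; apply/eq_bigr => x _.
rewrite -big_split /=; apply/eq_bigr => y _.
by rewrite mcoeffD mulrDr monalgUD.
Qed.

Lemma group_ring_mul0l : left_zero 0 group_ring_mul.
Proof. by move=> a; rewrite /group_ring_mul msupp0 big_seq_fset0. Qed.

Lemma group_ring_mul0r : right_zero 0 group_ring_mul.
Proof.
by move=> a; rewrite /group_ring_mul msupp0 big1 // => x _; rewrite big_seq_fset0.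
Qed.

Lemma group_ring_mulUU (k l : int) (x y : G) :
  << k *g x >> *G << l *g y >> = << k * l *g (x * y)%g >>.
Proof. by rewrite (group_ring_mulw msuppU_le msuppU_le) !big_seq_fset1 !mcoeffUU. Qed.

Lemma group_ring_mulsuml I (r : seq I) (F : I -> group_ring) b :
  (\sum_(i <- r) F i) *G b = \sum_(i <- r) F i *G b.
Proof.
exact: (big_morph (group_ring_mul^~ b)
  (fun _ _ => group_ring_mulDl _ _ _) (group_ring_mul0l _)).
Qed.

Lemma group_ring_mulsumr I (r : seq I) (F : I -> group_ring) a :
  a *G (\sum_(i <- r) F i) = \sum_(i <- r) a *G F i.
Proof.
exact: (big_morph (group_ring_mul a)
  (fun _ _ => group_ring_mulDr _ _ _) (group_ring_mul0r _)).
Qed.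

Lemma group_ring_mulA : associative group_ring_mul.
Proof.
move=> a b c; pose U e x := << e@_x *g x >> : group_ring.
rewrite (monalgE a) !(group_ring_mulsuml _ (U a)).
rewrite (group_ring_mulsuml _ (fun x => U a x *G b)); apply/eq_bigr => x _.
rewrite (monalgE b) (group_ring_mulsuml _ (U b)) !(group_ring_mulsumr _ _ (U a x)).
rewrite (group_ring_mulsuml _ (fun y => U a x *G U b y)); apply/eq_bigr => y _.
rewrite (monalgE c) !(group_ring_mulsumr _ (U c)).
rewrite (group_ring_mulsumr _ (fun z => U b y *G U c z)); apply/eq_bigr => z _.
by rewrite !group_ring_mulUU mulrA mulgA.
Qed.

Lemma group_ring_1mul : left_id group_ring_one group_ring_mul.
Proof.
move=> a; rewrite {2}[a]monalgE [a in LHS]monalgE group_ring_mulsumr.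
by apply/eq_bigr => x _; rewrite group_ring_mulUU mul1r mul1g.
Qed.

Lemma group_ring_mul1 : right_id group_ring_one group_ring_mul.
Proof.
move=> a; rewrite {2}[a]monalgE [a in LHS]monalgE group_ring_mulsuml.
by apply/eq_bigr => x _; rewrite group_ring_mulUU mulr1 mulg1.
Qed.

Lemma group_ring_oner_neq0 : group_ring_one != 0.
Proof. by apply/eqP/malgP => /(_ 1%g) /eqP; rewrite mcoeffUU mcoeff0. Qed.

HB.instance Definition _ := GRing.Zmodule_isNzRing.Build group_ring
  group_ring_mulA group_ring_1mul group_ring_mul1
  group_ring_mulDl group_ring_mulDr group_ring_oner_neq0.

Definition augmentation a : int := \sum_(x <- msupp a) a@_x.

Lemma augmentationw (d : {fset G}) a :
  fsubset (msupp a) d -> augmentation a = \sum_(x <- d) a@_x.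
Proof. by move=> le_d; apply/big_fset_incl => // x _ /mcoeff_outdom. Qed.

Lemma augmentationD a b : augmentation (a + b) = augmentation a + augmentation b.
Proof.
rewrite (augmentationw (fsubsetUl (msupp a) (msupp b))).
rewrite (augmentationw (fsubsetUr (msupp a) (msupp b))).
rewrite (augmentationw (msuppD_le _ _)) -big_split /=.
by apply/eq_bigr => x _; rewrite mcoeffD.
Qed.

Lemma augmentationU (k : int) (x : G) : augmentation << k *g x >> = k.
Proof. by rewrite (augmentationw msuppU_le) big_seq_fset1 mcoeffUU. Qed.

Lemma augmentation_sum I (r : seq I) (F : I -> group_ring) :
  augmentation (\sum_(i <- r) F i) = \sum_(i <- r) augmentation (F i).
Proof.
apply: (big_morph augmentation augmentationD).
by rewrite /augmentation msupp0 big_seq_fset0.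
Qed.

Lemma augmentationM a b : augmentation (a * b) = augmentation a * augmentation b.
Proof.
rewrite [a * b]/(a *G b) /group_ring_mul augmentation_sum mulr_suml.
apply/eq_bigr => x _; rewrite augmentation_sum mulr_sumr.
by apply/eq_bigr => y _; rewrite augmentationU.
Qed.


Definition trivial_scale a (k : trivial_module G) : trivial_module G :=
  augmentation a * (k : int).

Lemma trivial_scaleA a b k :
  trivial_scale a (trivial_scale b k) = trivial_scale (a * b) k.
Proof. by rewrite /trivial_scale augmentationM mulrA. Qed.

Lemma trivial_scale1 : left_id 1 trivial_scale.
Proof. by move=> k; rewrite /trivial_scale augmentationU mul1r. Qed.

Lemma trivial_scaleDr : right_distributive trivial_scale +%R.
Proof. by move=> a k l; exact: mulrDr. Qed.

Lemma trivial_scaleDl k : {morph trivial_scale^~ k : a b / a + b}.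
Proof. by move=> a b; rewrite /trivial_scale augmentationD; exact: mulrDl. Qed.

HB.instance Definition _ := GRing.Zmodule_isLmodule.Build group_ring (trivial_module G)
  trivial_scaleA trivial_scale1 trivial_scaleDr trivial_scaleDl.

End GroupRing.

Section Resolutions.
Variable R : nzRingType.

Definition is_basis (V : lmodType R) (I : choiceType) (b : I -> V) : Prop :=
  forall v : V, exists! c : {fsfun I -> R with 0},
    v = \sum_(i <- finsupp c) c i *: b i.

Definition is_free (V : lmodType R) : Prop :=
  exists (I : choiceType) (b : I -> V), is_basis b.

Definition is_free_of_rank (k : nat) (V : lmodType R) : Prop :=
  exists b : 'I_k -> V, is_basis b.

Definition finitely_generated (V : lmodType R) : Prop :=
  exists (k : nat) (g : 'I_k -> V),
    forall v : V, exists c : 'I_k -> R, v = \sum_(i < k) c i *: g i.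

(* diff j is the differential M_(j+1) -> M_j, usually numbered j+1, and aug is
   the map M_0 -> A, usually numbered 0. *)
Record resolution (A : lmodType R) := Resolution {
  term :> nat -> lmodType R;
  diff : forall j, {linear term j.+1 -> term j};
  aug : {linear term 0%N -> A};
  aug_surj : forall a : A, exists x, aug x = a;
  exact_at0 : forall x, aug x = 0 <-> exists y, diff 0%N y = x;
  exact_atS : forall j x, diff j x = 0 <-> exists y, diff j.+1 y = x
}.

(* A linear map bundled with its source and target, so that maps between equal
   but not convertible modules can be compared. *)
Definition arrow : Type :=
  {V : lmodType R & {W : lmodType R & {linear V -> W}}}.

Definition Arrow (V W : lmodType R) (f : {linear V -> W}) : arrow :=
  existT _ V (existT _ W f).

Definition finite_type (A : lmodType R) (M : resolution A) : Prop :=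
  forall j, finitely_generated (M j).

Definition free_resolution (A : lmodType R) (M : resolution A) : Prop :=
  forall j, is_free (M j).

(* In the second clause diff j.+2 and diff j are the differentials usually
   numbered j+3 and j+1, so that the latter runs over all numbers >= m + 1. *)
Definition two_periodic_from (m : nat) (A : lmodType R) (M : resolution A) : Prop :=
  (forall j, (m <= j)%N -> M j.+2 = M j) /\
  (forall j, (m <= j)%N -> Arrow (diff M j.+2) = Arrow (diff M j)).

End Resolutions.

(* Main.v *)
Require Import Defs.
From HB Require Import structures.
From mathcomp Require Import all_boot all_order all_fingroup all_algebra.
From mathcomp Require Import ssrAC generic_quotient finmap boolp.
From mathcomp.multinomials Require Import monalg.
From mathcomp Require Import zify ring.
From Stdlib Require Import Setoid Morphisms.

(** By Garside's theory the positive braid monoid embeds in the braid group, any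
    set S of generators has a least common multiple lcm S there, and the center
    is infinite cyclic, generated by some z.  The positive braids other than 1
    are covered by the multiples of the generators, so inclusion-exclusion gives
    an exact complex with one generator, of degree |S|, for each S.  It is the
    leading part, for the length filtration, of a free resolution of Z over the
    group ring of the braid group with differential D of the same shape.  Let
    w = z - 1, a central regular element that kills Z.  Adding to D entries that
    raise the degree gives a matrix H with H^2 = w; reducing H modulo w and
    truncating at degree j for each j gives a resolution over the group ring of
    the quotient.  In degree j its basis is the set of all S with |S| <= j and
    |S| = j mod 2, which depends only on the parity of j once j >= n. *)

Set Implicit Arguments.
Unset Strict Implicit.
Unset Printing Implicit Defensive.

Import GRing.Theory.
Local Open Scope quotient_scope.

(** * The positive braid monoid *)

(** The inclusion-exclusion complex is not yet the right one: over the positive monoid it resolves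
    the module on which every generator acts as 0, and this module dies over the group ring.
    Corrections of lower length make the generators act as 1; in degree one they turn the entry s
    into s - 1, up to a unit. Exactness survives by induction on length, which needs positive
    supports; a power of the central full twist moves any vector over the group ring there.

    Since w kills Z, multiplication by w is homotopic to 0 on the resolution. A homotopy h with D h
    + h D = w need not satisfy h^2 = 0, so higher homotopies are added, as in the constructions of
    Shamash and Eisenbud; their sum with D is H, a matrix factorization of w. The truncations of H
    amount to a tensor product with divided powers of a variable of degree 2: a cell S reappears in
    the degrees |S|, |S| + 2, and so on. From degree n on, each term therefore contains all cells of
    one parity, half of the 2^n subsets of the n generators. *)

Definition adjacent (i j : nat) := (j == i.+1) || (i == j.+1).

(** [i :: complement i j] spells the least common multiple of the letters [i] and [j], so that the
    single relation [PeqRel] covers the braid relation, commutation and the trivial case [i = j]. *)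
Definition complement (i j : nat) : seq nat :=
  if i == j then [::] else if adjacent i j then [:: j; i] else [:: j].

Inductive peq : seq nat -> seq nat -> Prop :=
| PeqRefl u : peq u u
| PeqSym u v : peq u v -> peq v u
| PeqTrans u v w : peq u v -> peq v w -> peq u w
| PeqCat u u' v v' : peq u u' -> peq v v' -> peq (u ++ v) (u' ++ v')
| PeqRel i j : peq (i :: complement i j) (j :: complement j i).

#[export] Hint Resolve PeqRefl : core.

#[export] Instance peq_equivalence : Equivalence peq.
Proof. by split; [exact: PeqRefl | exact: PeqSym | exact: PeqTrans]. Qed.

#[export] Instance cat_peq : Proper (peq ==> peq ==> peq) (@cat nat).
Proof. by move=> u u' uu' v v' vv'; exact: PeqCat. Qed.

#[export] Instance cons_peq : Proper (eq ==> peq ==> peq) (@cons nat).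
Proof.
by move=> i _ <- u v uv; rewrite -(cat1s i u) -(cat1s i v); apply: PeqCat.
Qed.

Lemma peq_size u v : peq u v -> size u = size v.
Proof.
elim=> {u v} [//|u v _ -> //|u v w _ -> _ -> //|u u' v v' _ eu _ ev|i j].
  by rewrite !size_cat eu ev.
rewrite /complement [adjacent j i]orbC -/(adjacent i j) eq_sym.
by case: eqP => // _; case: adjacent.
Qed.

Lemma adjacentC i j : adjacent i j = adjacent j i.
Proof. by rewrite /adjacent orbC. Qed.

Lemma complement_eq i : complement i i = [::].
Proof. by rewrite /complement eqxx. Qed.

Lemma complement_adj i j : adjacent i j -> complement i j = [:: j; i].
Proof.
move=> adj; rewrite /complement adj.
by have -> : (i == j) = false by move: adj; rewrite /adjacent; lia.
Qed.

Lemma complement_nadj i j : i != j -> ~~ adjacent i j -> complement i j = [:: j].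
Proof. by move=> neq nadj; rewrite /complement (negPf neq) (negPf nadj). Qed.

Lemma peq_braid i j u : adjacent i j -> peq (i :: j :: i :: u) (j :: i :: j :: u).
Proof.
move=> adj; have := PeqRel i j; have adj' : adjacent j i by rewrite adjacentC.
rewrite !complement_adj //.
by move=> rel; apply: (PeqCat rel (PeqRefl u)).
Qed.

Lemma peq_comm i j u : ~~ adjacent i j -> peq (i :: j :: u) (j :: i :: u).
Proof.
move=> nadj; have [->//|neq_ij] := eqVneq i j.
have := PeqRel i j; rewrite !complement_nadj // 1?eq_sym 1?adjacentC //.
by move=> rel; apply: (PeqCat rel (PeqRefl u)).
Qed.

(* Equivalent words factor through the least common multiple of their first
   letters (Garside); this is transitive by the cube condition below. *)
Definition headed_peq (u v : seq nat) : Prop :=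
  match u, v with
  | [::], [::] => True
  | i :: u', j :: v' =>
      exists w, peq u' (complement i j ++ w) /\ peq v' (complement j i ++ w)
  | _, _ => False
  end.


Ltac peq_size_lia :=
  repeat match goal with H : peq _ _ |- _ => move: (peq_size H) => /= {H} end;
  rewrite /= ?size_cat /=; lia.

Ltac letter_lia := clear; rewrite /adjacent; lia.

(** * The cube condition for three generators *)

Section Cube.
Variable N : nat.
Hypothesis headed : forall u v, size u <= N -> peq u v -> headed_peq u v.
Implicit Types (a b i j k : nat) (u v w x y : seq nat).

Let cancel a u v : size u < N -> peq (a :: u) (a :: v) -> peq u v.
Proof.
move=> le_u /headed [//|w]; rewrite complement_eq /= => -[-> ->]; exact: PeqRefl.
Qed.

Let cancel_adj a b u v : adjacent a b -> size u < N -> peq (a :: u) (b :: v) ->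
  exists2 w, peq u (b :: a :: w) & peq v (a :: b :: w).
Proof.
move=> adj le_u /headed [//|w]; rewrite complement_adj // complement_adj 1?adjacentC //.
by move=> [eu ev]; exists w.
Qed.

Let cancel_nadj a b u v : a != b -> ~~ adjacent a b -> size u < N ->
  peq (a :: u) (b :: v) -> exists2 w, peq u (b :: w) & peq v (a :: w).
Proof.
move=> neq nadj le_u /headed [//|w].
rewrite complement_nadj // complement_nadj 1?eq_sym 1?adjacentC //.
by move=> [eu ev]; exists w.
Qed.

Let has_lcm i k u w :=
  exists t, peq u (complement i k ++ t) /\ peq w (complement k i ++ t).

Section Cases.
Variables (i j k : nat) (u v w x y : seq nat).
Hypothesis sv : size v <= N.

(** The suffix tells whether the pairs (i, j), (j, k), (i, k) are adjacent (a) or not (n). In each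
    case the two factorizations of [v] are compared by the induction hypothesis [headed], and the
    common tail found there is moved into place by the relations. *)
Lemma cube_nnn : i != j -> j != k -> i != k ->
  ~~ adjacent i j -> ~~ adjacent j k -> ~~ adjacent i k ->
  peq u (j :: x) -> peq v (i :: x) -> peq v (k :: y) -> peq w (j :: y) ->
  has_lcm i k u w.
Proof.
move=> nij njk nik aij ajk aik ux vx vy wy.
have nki : k != i by rewrite eq_sym.
have aki : ~~ adjacent k i by rewrite adjacentC.
have aji : ~~ adjacent j i by rewrite adjacentC.
have /(cancel_nadj nik aik) [|x' xx yx] : peq (i :: x) (k :: y).
- by rewrite -vx vy.
- by peq_size_lia.
exists (j :: x'); rewrite !complement_nadj //=; split.
  by rewrite ux xx peq_comm.
by rewrite wy yx peq_comm.
Qed.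

Lemma cube_nna : ~~ adjacent i j -> ~~ adjacent j k -> adjacent i k ->
  peq u (j :: x) -> peq v (i :: x) -> peq v (k :: y) -> peq w (j :: y) ->
  has_lcm i k u w.
Proof.
move=> aij ajk aik ux vx vy wy.
have aki : adjacent k i by rewrite adjacentC.
have aji : ~~ adjacent j i by rewrite adjacentC.
have /(cancel_adj aik) [|x' xx yx] : peq (i :: x) (k :: y).
- by rewrite -vx vy.
- by peq_size_lia.
exists (j :: x'); rewrite !complement_adj //=; split.
  by rewrite ux xx (peq_comm _ ajk) (peq_comm _ aji).
by rewrite wy yx (peq_comm _ aji) (peq_comm _ ajk).
Qed.

Lemma cube_nan : i != j -> i != k ->
  ~~ adjacent i j -> adjacent j k -> ~~ adjacent i k ->
  peq u (j :: x) -> peq v (i :: x) -> peq v (k :: j :: y) -> peq w (j :: k :: y) ->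
  has_lcm i k u w.
Proof.
move=> nij nik aij ajk aik ux vx vy wy.
have nki : k != i by rewrite eq_sym.
have nji : j != i by rewrite eq_sym.
have aki : ~~ adjacent k i by rewrite adjacentC.
have aji : ~~ adjacent j i by rewrite adjacentC.
have /(cancel_nadj nik aik) [|x' xx /(cancel_nadj nji aji) [|y' yy xy]] :
  peq (i :: x) (k :: j :: y).
- by rewrite -vx vy.
- by peq_size_lia.
- by peq_size_lia.
exists (j :: k :: y'); rewrite !complement_nadj //=; split.
  by rewrite ux xx xy (peq_braid _ ajk).
by rewrite wy yy (peq_comm _ aki) (peq_comm _ aji).
Qed.

Lemma cube_naa : i != j -> ~~ adjacent i j -> adjacent j k -> adjacent i k ->
  peq u (j :: x) -> peq v (i :: x) -> peq v (k :: j :: y) -> peq w (j :: k :: y) ->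
  has_lcm i k u w.
Proof.
move=> nij aij ajk aik ux vx vy wy.
have nji : j != i by rewrite eq_sym.
have aji : ~~ adjacent j i by rewrite adjacentC.
have akj : adjacent k j by rewrite adjacentC.
have aki : adjacent k i by rewrite adjacentC.
have /(cancel_adj aik) [|x' xx /(cancel_nadj nji aji) [|y' yy]] :
  peq (i :: x) (k :: j :: y).
- by rewrite -vx vy.
- by peq_size_lia.
- by peq_size_lia.
case/(cancel_adj akj) => [|t xt yt]; first by peq_size_lia.
exists (j :: k :: i :: t); rewrite !complement_adj //=; split.
  rewrite ux xx xt (peq_comm (k :: t) aij) (peq_braid _ ajk).
  by rewrite (peq_braid t aki) (peq_comm _ aji).
rewrite wy yy yt (peq_braid _ aki).
by rewrite (peq_comm _ aji) (peq_comm t aij) (peq_braid _ ajk).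
Qed.

Lemma cube_aan : i != k -> adjacent i j -> adjacent j k -> ~~ adjacent i k ->
  peq u (j :: i :: x) -> peq v (i :: j :: x) -> peq v (k :: j :: y) ->
  peq w (j :: k :: y) -> has_lcm i k u w.
Proof.
move=> nik aij ajk aik ux vx vy wy.
have nki : k != i by rewrite eq_sym.
have aji : adjacent j i by rewrite adjacentC.
have akj : adjacent k j by rewrite adjacentC.
have aki : ~~ adjacent k i by rewrite adjacentC.
have /(cancel_nadj nik aik) [|x' xx yx] : peq (i :: j :: x) (k :: j :: y).
- by rewrite -vx vy.
- by peq_size_lia.
case: (cancel_adj ajk _ xx) => [|w1 xw1 x'w1]; first by peq_size_lia.
case: (cancel_adj aji _ yx) => [|w2 yw2 x'w2]; first by peq_size_lia.
have /cancel : peq (j :: k :: w1) (j :: i :: w2) by rewrite -x'w1 x'w2.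
case/(_ _)/(cancel_nadj nki aki) => [||t w1t w2t]; try by peq_size_lia.
exists (j :: k :: i :: j :: t); rewrite !complement_nadj //=; split.
  by rewrite ux xw1 w1t (peq_comm _ aik) (peq_braid t aij) (peq_braid _ ajk).
by rewrite wy yw2 w2t (peq_comm _ aki) (peq_braid t akj) (peq_braid _ aji)
  (peq_comm (j :: t) aik).
Qed.

End Cases.

Let cancel_cat c u v : size (c ++ u) <= N -> peq (c ++ u) (c ++ v) -> peq u v.
Proof.
elim: c => //= a c IHc sz /(cancel sz); apply: IHc; exact: ltnW.
Qed.

(** This is the transitivity of [headed_peq], with [j :: v] as the middle word. Three pairwise
    adjacent letters do not exist, and exchanging [i] and [k] reduces the other configurations of
    distinct letters to the five cases above. *)
Lemma headed_peq_cube i j k u v w x y : size v <= N ->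
  peq u (complement i j ++ x) -> peq v (complement j i ++ x) ->
  peq v (complement j k ++ y) -> peq w (complement k j ++ y) ->
  has_lcm i k u w.
Proof.
move=> sv; have [<-|nij] := eqVneq i j.
  by rewrite complement_eq => ux vx vy wy; exists y; rewrite ux -vx -vy.
have [<-|njk] := eqVneq j k.
  by rewrite complement_eq => ux vx vy wy; exists x; rewrite wy -vy -vx.
have [eq_ik|nik] := eqVneq i k.
  rewrite -{k}eq_ik in njk * => ux vx vy wy.
  exists u; rewrite complement_eq; split=> //; rewrite wy ux.
  suff -> : peq x y by [].
  by apply: (@cancel_cat (complement j i)); rewrite -?vx // -(peq_size vx).
have nji : j != i by rewrite eq_sym.
have nkj : k != j by rewrite eq_sym.
have nki : k != i by rewrite eq_sym.
have [aij|aij] := boolP (adjacent i j); have [ajk|ajk] := boolP (adjacent j k);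
  (have aji := aij; rewrite adjacentC in aji; have akj := ajk; rewrite adjacentC in akj;
   rewrite 1?(complement_adj aij) 1?(complement_adj aji) 1?(complement_nadj nij aij)
      1?(complement_nadj nji aji) 1?(complement_adj ajk) 1?(complement_adj akj)
      1?(complement_nadj njk ajk) 1?(complement_nadj nkj akj) /=);
  have [aik|aik] := boolP (adjacent i k); move=> ux vx vy wy;
  have aki := aik; rewrite adjacentC in aki.
- by move: aij ajk aik; letter_lia.
- exact: cube_aan ux vx vy wy.
- by case: (cube_naa sv _ _ _ _ wy vy vx ux) => // t [? ?]; exists t.
- by case: (cube_nan sv _ _ _ _ _ wy vy vx ux) => // t [? ?]; exists t.
- exact: cube_naa ux vx vy wy.
- exact: cube_nan ux vx vy wy.
- exact: cube_nna ux vx vy wy.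
- exact: cube_nnn ux vx vy wy.
Qed.

End Cube.

(** Induction on the length, and inside it on the derivation: transitivity at one length uses the
    statement only for the shorter tails. *)
Theorem peq_headed u v : peq u v -> headed_peq u v.
Proof.
have [N] := ubnP (size u); elim: N u v => // N IHN u v.
have {}IHN u' v' : (size u' < N) -> peq u' v' -> headed_peq u' v'.
  exact: IHN.
move=> + uv; elim: uv => {u v}
  [u _|u v uv IH sv|u v w uv IHu vw IHv su|u u' v v' uu' IHu vv' IHv|i j _].
- by case: u => // i u; exists u; rewrite complement_eq.
- move: (IH); rewrite (peq_size uv) => /(_ sv) /=.
  by case: u v {uv IH sv} => [|i u] [|j v] // [w [? ?]]; exists w.
- have sv := su; rewrite (peq_size uv) in sv.
  move: (IHu su) (IHv sv) => {IHu IHv su}; move: sv.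
  case: u v w {uv vw} => [|i u] [|j v] [|k w] //= sv [x [ux vx]] [y [vy wy]].
  have sv' : size v <= N.-1 by lia.
  apply: (headed_peq_cube _ sv' ux vx vy wy) => u' v' ?.
  by apply: IHN; lia.
- rewrite size_cat => sz; move: IHu IHv.
  case: u u' uu' sz => [|i u] [|j u'] uu' /=; try by move: (peq_size uu').
    by move=> sv _ /(_ sv).
  move=> sz /(_ _) [|x [ux u'x] _]; first by lia.
  by exists (x ++ v); rewrite !catA ux u'x vv'.
- by exists [::]; rewrite !cats0.
Qed.

Lemma peq_cancel w u v : peq (w ++ u) (w ++ v) -> peq u v.
Proof.
elim: w => //= i w IHw /peq_headed [x [ux vx]]; apply: IHw.
by rewrite ux vx complement_eq.
Qed.

Lemma peq_cons i j u v : peq (i :: u) (j :: v) ->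
  exists w, peq u (complement i j ++ w) /\ peq v (complement j i ++ w).
Proof. exact: peq_headed. Qed.

Lemma peq_all (a : pred nat) u v : peq u v -> all a u = all a v.
Proof.
elim=> {u v} [//|u v _ -> //|u v w _ -> //|u u' v v' _ eu _ ev|i j].
  by rewrite !all_cat eu ev.
rewrite /complement adjacentC eq_sym.
by case: eqP => [->//|_]; case: adjacent => /=; rewrite !andbT; do 2?case: (a _).
Qed.

(** * The full twist *)

(* The word delta ^ k, where delta = sigma_1 ... sigma_(m+1); it is locked because
   catA would otherwise unify with the concatenations hidden in it. *)
HB.lock Definition delta_pow (m k : nat) : seq nat := flatten (nseq k (iota 0 m.+1)).

Section FullTwist.
Variable m : nat.
Local Notation delta_pow := (delta_pow m).

Definition full_twist := delta_pow m.+2.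
(** The full twist with the letter 0 dropped from one factor delta. As i delta^i = delta^i 0, a
    letter [i] put in front restores it. *)
Definition twist_quotient (i : nat) :=
  delta_pow i ++ iota 1 m ++ delta_pow (m.+1 - i).

Definition twist_pow k := flatten (nseq k full_twist).

Lemma twist_powD j k : twist_pow (j + k) = twist_pow j ++ twist_pow k.
Proof. by rewrite /twist_pow nseqD flatten_cat. Qed.

Lemma delta_powD j k : delta_pow (j + k) = delta_pow j ++ delta_pow k.
Proof. by rewrite delta_pow.unlock nseqD flatten_cat. Qed.

Lemma delta_pow0 : delta_pow 0 = [::].
Proof. by rewrite delta_pow.unlock. Qed.

Lemma delta_pow1 : delta_pow 1 = iota 0 m.+1.
Proof. by rewrite delta_pow.unlock /= cats0. Qed.

Lemma full_twist_split i : i <= m ->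
  full_twist = delta_pow i ++ delta_pow 2 ++ delta_pow (m - i).
Proof. by move=> le_i; rewrite -!delta_powD; congr delta_pow; lia. Qed.

Lemma twist_pow1 : twist_pow 1 = full_twist.
Proof. by rewrite /twist_pow /= cats0. Qed.

Lemma delta_pow_letters k : all (fun i => i <= m) (delta_pow k).
Proof.
rewrite delta_pow.unlock; apply/allP => i /flattenP [s /nseqP [-> _]].
rewrite mem_iota; lia.
Qed.

Lemma twist_quotient_letters i : all (fun i => i <= m) (twist_quotient i).
Proof.
rewrite !all_cat !delta_pow_letters andbT /=.
by apply/allP => j; rewrite mem_iota; lia.
Qed.

Lemma twist_quotient_split i : i <= m ->
  full_twist = delta_pow i ++ 0 :: iota 1 m ++ delta_pow (m.+1 - i).
Proof.
move=> le_i; rewrite -[0 :: _]/(iota 0 m.+1 ++ _) -delta_pow1 -!delta_powD.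
by congr delta_pow; lia.
Qed.

Lemma peq_cat_comm (i : nat) p :
  all (fun j => ~~ adjacent j i) p -> peq (p ++ [:: i]) (i :: p).
Proof.
elim: p => //= j p IHp /andP [nadj /IHp ->]; exact: peq_comm.
Qed.

Lemma delta_shift (i : nat) : i < m ->
  peq (delta_pow 1 ++ [:: i]) (i.+1 :: delta_pow 1).
Proof.
move=> lt_i; rewrite delta_pow1.
have -> : m.+1 = i + (2 + (m - i.+1)) by lia.
rewrite iotaD add0n iotaD /= -addn2.
rewrite -catA /= peq_cat_comm; last first.
  by apply/allP => j; rewrite mem_iota /adjacent; lia.
rewrite peq_braid ?addn2 ?addn1; last by rewrite /adjacent; lia.
rewrite -[_ :: _ :: _ :: _]cat1s catA peq_cat_comm //.
by apply/allP => j; rewrite mem_iota /adjacent; lia.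
Qed.

Lemma delta_pow_shift (i k : nat) : i + k <= m ->
  peq (delta_pow k ++ [:: i]) (i + k :: delta_pow k).
Proof.
elim: k => [|k IHk] le_m; first by rewrite addn0 delta_pow0.
rewrite -add1n delta_powD -catA IHk; last by lia.
rewrite -cat1s catA delta_shift; last by lia.
by rewrite addnS.
Qed.

(** Moving delta past all letters but the last gives delta^2 = (1 ... m) delta m; a 0 in front
    completes another delta. *)
Lemma delta_sqr_last : peq (delta_pow 2 ++ [:: m]) (0 :: delta_pow 2).
Proof.
have shift k : k <= m -> peq (delta_pow 1 ++ iota 0 k) (iota 1 k ++ delta_pow 1).
  elim: k => [|k IHk] lt_k; first by rewrite cats0.
  rewrite -[k.+1]addn1 !iotaD catA IHk 1?ltnW // -catA add0n.
  by rewrite [iota k 1]/= delta_shift // -catA add1n.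
have deltaE : delta_pow 1 = iota 0 m ++ [:: m].
  by rewrite delta_pow1 -[m.+1]addn1 iotaD.
have delta0E : 0 :: iota 1 m = delta_pow 1 by rewrite delta_pow1.
have deltaSqE : peq (delta_pow 2) (iota 1 m ++ delta_pow 1 ++ [:: m]).
  by rewrite (delta_powD 1 1) {2}deltaE catA shift // -catA.
by rewrite {2}deltaSqE (delta_powD 1 1) -{1}delta0E /= -catA.
Qed.

(** From the right, delta^(m - i) raises the letter to [m], delta^2 wraps it round to 0, and delta^i
    brings it back to [i]: m + 2 factors in all. *)
Lemma full_twist_letter (i : nat) : i <= m ->
  peq (full_twist ++ [:: i]) (i :: full_twist).
Proof.
move=> le_i; rewrite (full_twist_split le_i) -!catA delta_pow_shift; last by lia.
have -> : i + (m - i) = m by lia.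
rewrite -[m :: _]cat1s (catA (delta_pow 2)) delta_sqr_last.
by rewrite /= -cat1s catA delta_pow_shift ?add0n.
Qed.

Lemma full_twist_central u : all (fun i => i <= m) u ->
  peq (full_twist ++ u) (u ++ full_twist).
Proof.
elim: u => [|i u IHu] /=; first by rewrite cats0.
move=> /andP [le_i /IHu <-].
by rewrite -[i :: u]cat1s catA full_twist_letter.
Qed.

Lemma twist_quotientl (i : nat) : i <= m ->
  peq (i :: twist_quotient i) full_twist.
Proof.
move=> le_i; rewrite (twist_quotient_split le_i).
by rewrite -[0 :: _]cat1s catA delta_pow_shift ?add0n.
Qed.

Lemma twist_quotientr (i : nat) : i <= m ->
  peq (twist_quotient i ++ [:: i]) full_twist.
Proof.
move=> le_i; apply: (@peq_cancel [:: i]); rewrite !cat1s.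
apply: PeqTrans (full_twist_letter le_i).
exact: (PeqCat (twist_quotientl le_i) (PeqRefl [:: i])).
Qed.

Lemma twist_pow_central k u : all (fun i => i <= m) u ->
  peq (twist_pow k ++ u) (u ++ twist_pow k).
Proof.
move=> uP; elim: k => [|k IHk]; first by rewrite cats0.
rewrite -addn1 twist_powD.
by rewrite twist_pow1 -catA full_twist_central // catA IHk catA.
Qed.

End FullTwist.

(** * Embedding of the positive monoid *)

Section PositiveBraids.
Variable m : nat.
Local Notation B := (braid m.+2).
Local Notation letters := (all (fun i => i <= m)).

(** [inord] gives letters above [m] a default value, whence the hypotheses [letters] below. *)
Definition sigma (i : nat) : B := \pi_(braid m.+2) [:: (inord i : 'I_(m.+2).-1, true)].

(* The order is reversed, so that the first letter becomes a right divisor. *)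
Definition eval_word (u : seq nat) : B := foldr (fun i x => (x * sigma i)%g) 1%g u.

Lemma eval_word_cat u v : eval_word (u ++ v) = (eval_word v * eval_word u)%g.
Proof. by elim: u => [|i u IHu] /=; rewrite ?mulg1 // IHu mulgA. Qed.

Lemma piM (u v : braid_word m.+2) :
  (\pi_(braid m.+2) u * \pi_(braid m.+2) v)%g = \pi_(braid m.+2) (u ++ v) :> B.
Proof. exact: braid_mulE. Qed.

Lemma eq_piP (u v : braid_word m.+2) :
  \pi_(braid m.+2) u = \pi_(braid m.+2) v :> B <-> braid_equiv u v.
Proof. by split=> [/eq_braidP/asboolP|uv] //; apply/eq_braidP/asboolP. Qed.

Lemma sigma_braid i : i < m ->
  (sigma i * sigma i.+1 * sigma i = sigma i.+1 * sigma i * sigma i.+1)%g.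
Proof.
move=> lt_i; rewrite /sigma !piM; apply/eq_piP/BraidBraid.
by rewrite !inordK // ltnW.
Qed.

Lemma sigma_comm i j : i <= m -> j <= m -> ~~ adjacent i j ->
  (sigma i * sigma j = sigma j * sigma i)%g.
Proof.
move=> le_i le_j nadj; have [->//|neq] := eqVneq i j.
rewrite /sigma !piM; apply/eq_piP/BraidComm.
by rewrite !inordK //; move: nadj; rewrite /adjacent; lia.
Qed.

Lemma peq_eval u v : peq u v -> letters u -> eval_word u = eval_word v.
Proof.
elim=> {u v} [//|u v uv IH lv|u v w uv IHu vw IHv lu|u u' v v' _ IHu _ IHv|i j].
- by rewrite IH // (peq_all _ uv).
- by rewrite IHu // IHv // -(peq_all _ uv).
- by rewrite all_cat !eval_word_cat => /andP [/IHu -> /IHv ->].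
have [<-//|neq] := eqVneq i j; have neq' : j != i by rewrite eq_sym.
have [adj|nadj] := boolP (adjacent i j); last first.
  rewrite !complement_nadj //= 1?adjacentC // => /and3P [? ? _].
  by rewrite !mul1g sigma_comm // adjacentC.
rewrite !complement_adj //= 1?adjacentC // !mul1g => /and4P [? ? _ _].
move: adj; rewrite /adjacent => /orP [] /eqP e; rewrite e in neq *.
  by rewrite sigma_braid //; lia.
by rewrite sigma_braid //; lia.
Qed.

Lemma braid_rep (x : B) : exists u, x = \pi_(braid m.+2) u.
Proof. by exists (repr x); rewrite reprK. Qed.

Local Notation letter := ('I_(m.+2).-1 * bool)%type.

(* A braid word w is full_twist ^ - twist_count w times the positive word
   clear_denominators w, where the inverse of sigma_i is replaced by
   full_twist / sigma_i. *)
Fixpoint clear_denominators (w : seq letter) : seq nat :=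
  if w is a :: w' then
    clear_denominators w' ++ (if a.2 then [:: val a.1] else twist_quotient m (val a.1))
  else [::].

Definition twist_count (w : seq letter) : nat := count (fun a => ~~ a.2) w.

Lemma clear_denominators_cat u v :
  clear_denominators (u ++ v) = clear_denominators v ++ clear_denominators u.
Proof. by elim: u => [|a u IHu] /=; rewrite ?cats0 // IHu catA. Qed.

Lemma letter_le (i : 'I_(m.+2).-1) : i <= m.
Proof. by case: i => i /=; rewrite ltnS. Qed.

Lemma clear_denominators_letters w : letters (clear_denominators w).
Proof.
elim: w => //= -[i b] w IHw; rewrite all_cat IHw /=.
by case: b => /=; rewrite ?letter_le ?twist_quotient_letters.
Qed.

(** Fractions over powers of the full twist are compared by cross-multiplication: transitivity needs
    cancellation, products need centrality. For words without inverses there is no denominator, and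
    the embedding of the positive monoid follows. *)
Lemma braid_equiv_clear u v : braid_equiv u v ->
  peq (twist_pow m (twist_count v) ++ clear_denominators u)
      (twist_pow m (twist_count u) ++ clear_denominators v).
Proof.
elim=> {u v} [u|u v _ IH|u v w _ uv _ vw|u u' v v' _ uu' _ vv'|i b|i j ij|i j ij].
- by [].
- exact: PeqSym.
- apply: (@peq_cancel (twist_pow m (twist_count v))).
  rewrite catA -twist_powD addnC twist_powD -catA uv.
  rewrite catA -twist_powD addnC twist_powD -catA vw.
  by rewrite !catA -!twist_powD addnC.
- rewrite !clear_denominators_cat /twist_count !count_cat -!/(twist_count _).
  have twistC k w x : peq (twist_pow m k ++ clear_denominators w ++ x)
                        (clear_denominators w ++ twist_pow m k ++ x).
    by rewrite !catA twist_pow_central ?clear_denominators_letters.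
  rewrite (addnC (twist_count u')) (addnC (twist_count u)) !twist_powD -!catA.
  by rewrite (twistC (twist_count u')) uu' catA vv' -catA (twistC (twist_count u)).
- case: b; rewrite /= ?cats0 /=.
    by rewrite (twist_quotientr (letter_le i)) -twist_pow1.
  by rewrite (twist_quotientl (letter_le i)) -twist_pow1.
- by apply: (@peq_braid i j [::]); rewrite /adjacent ij eqxx.
- by apply: (@peq_comm j i [::]); move: ij; letter_lia.
Qed.

Definition positive_word (u : seq nat) : seq letter :=
  rev [seq (inord i : 'I_(m.+2).-1, true) | i <- u].

Lemma eval_wordE u : eval_word u = \pi_(braid m.+2) (positive_word u).
Proof.
elim: u => //= i u ->.
by rewrite /sigma piM /positive_word map_cons rev_cons cats1.
Qed.

Lemma clear_positive u : letters u -> clear_denominators (positive_word u) = u.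
Proof.
elim: u => //= i u IHu /andP [le_i lu].
rewrite /positive_word map_cons rev_cons -cats1 clear_denominators_cat /=.
by rewrite IHu // inordK.
Qed.

Lemma twist_count_positive u : twist_count (positive_word u) = 0.
Proof.
by rewrite /twist_count /positive_word count_rev count_map; elim: u.
Qed.

Lemma eval_word_inj u v : letters u -> letters v ->
  eval_word u = eval_word v -> peq u v.
Proof.
move=> lu lv; rewrite !eval_wordE => /eq_piP /braid_equiv_clear.
by rewrite !twist_count_positive !clear_positive.
Qed.
End PositiveBraids.

(** * Divisibility of positive braids *)

Section Divisibility.
Variable m : nat.
Local Notation B := (braid m.+2).
Local Notation letters := (all (fun i => i <= m)).
Local Notation sigma := (@sigma m).
Local Notation eval_word := (@eval_word m).
Local Open Scope group_scope.

Definition positive (x : B) : Prop := exists2 u, letters u & x = eval_word u.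
Definition divides (d x : B) : Prop := positive (x * d^-1).

(** The exponent sum. It descends to braids because the relations are homogeneous. *)
Definition word_len (w : braid_word m.+2) : int :=
  (\sum_(a <- w) (if a.2 then 1 else -1))%R.
Definition len (x : B) : int := word_len (repr x).

Lemma word_len_cat u v : word_len (u ++ v) = (word_len u + word_len v)%R.
Proof. exact: big_cat. Qed.

Lemma braid_equiv_word_len u v : braid_equiv u v -> word_len u = word_len v.
Proof.
elim=> {u v} [//|u v _ -> //|u v w _ -> _ -> //|u u' v v' _ eu _ ev|i b|i j _|i j _].
- by rewrite !word_len_cat eu ev.
- by case: b; rewrite /word_len !big_cons big_nil.
- by rewrite /word_len !big_cons big_nil.
- by rewrite /word_len !big_cons big_nil.
Qed.

Lemma len_pi u : len (\pi_(braid m.+2) u) = word_len u.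
Proof. exact/braid_equiv_word_len/repr_braid. Qed.

Lemma lenM x y : len (x * y) = (len x + len y)%R.
Proof.
have [u ->] := braid_rep x; have [v ->] := braid_rep y.
by rewrite piM !len_pi word_len_cat.
Qed.

Lemma len1 : len 1 = 0%R.
Proof. by apply: (addrI (len 1)); rewrite -lenM mulg1 addr0. Qed.

Lemma lenV x : len x^-1 = (- len x)%R.
Proof. by apply: (addrI (len x)); rewrite -lenM mulgV len1 subrr. Qed.

Lemma len_sigma i : len (sigma i) = 1%R.
Proof. by rewrite len_pi /word_len big_seq1. Qed.

Lemma len_eval u : len (eval_word u) = Posz (size u).
Proof.
elim: u => [|i u IHu] /=; first exact: len1.
by rewrite lenM IHu len_sigma -addn1 PoszD.
Qed.

Lemma positive1 : positive 1.
Proof. by exists [::]. Qed.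

Lemma positiveM x y : positive x -> positive y -> positive (x * y).
Proof.
move=> [u lu ->] [v lv ->]; exists (v ++ u); first by rewrite all_cat lu lv.
by rewrite eval_word_cat.
Qed.

Lemma positive_sigma i : i <= m -> positive (sigma i).
Proof. by move=> le_i; exists [:: i]; rewrite /= ?le_i // mul1g. Qed.

Lemma positive_len_ge0 x : positive x -> (0 <= len x)%R.
Proof. by move=> [u _ ->]; rewrite len_eval. Qed.

Lemma positive_len0 x : positive x -> len x = 0%R -> x = 1.
Proof. by move=> [u _ ->]; rewrite len_eval; case: u. Qed.

Lemma positive_case x : positive x ->
  x = 1 \/ exists i y, [/\ i <= m, positive y & x = y * sigma i].
Proof.
move=> [[|i u] /= lu ->]; first by left.
by case/andP: lu => le_i lu; right; exists i, (eval_word u); split=> //; exists u.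
Qed.

Lemma divides_refl x : divides x x.
Proof. by rewrite /divides mulgV; exact: positive1. Qed.

Lemma divides_trans y x z : divides x y -> divides y z -> divides x z.
Proof.
rewrite /divides => xy yz.
by rewrite -(mulgKV y z) -mulgA; exact: positiveM.
Qed.

Lemma divides1 x : positive x -> divides 1 x.
Proof. by rewrite /divides invg1 mulg1. Qed.

Lemma divides_mull y d : positive y -> divides d (y * d).
Proof. by rewrite /divides mulgK. Qed.

Lemma divides_mulr y d x : divides d x -> divides (d * y) (x * y).
Proof. by rewrite /divides invMg mulgA mulgK. Qed.

Lemma divides_mulrV y d x : divides (d * y) x -> divides d (x * y^-1).
Proof. by rewrite /divides invMg mulgA. Qed.

Lemma divides_len d x : divides d x -> (len d <= len x)%R.
Proof. by move/positive_len_ge0; rewrite lenM lenV; lia. Qed.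

Lemma divides_eq d x : divides d x -> len x = len d -> x = d.
Proof.
move=> dx e; apply: (mulIg d^-1); rewrite mulgV; apply: positive_len0 => //.
by rewrite lenM lenV e subrr.
Qed.

Definition lcm_sigma i j := eval_word (i :: complement i j).

Lemma positive_complement i j : j <= m -> i <= m -> positive (eval_word (complement i j)).
Proof.
move=> le_j le_i; exists (complement i j) => //; rewrite /complement.
by case: (i == j) => //=; case: adjacent; rewrite /= le_j ?le_i.
Qed.

Lemma divides_lcm_sigma i j x : i <= m -> j <= m ->
  divides (sigma i) x -> divides (sigma j) x -> divides (lcm_sigma i j) x.
Proof.
move=> le_i le_j [u lu xu] [v lv xv].
have xiu : x = eval_word (i :: u) by rewrite /= -xu mulgKV.
have xjv : x = eval_word (j :: v) by rewrite /= -xv mulgKV.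
have /peq_cons [w [uw _]] : peq (i :: u) (j :: v).
  apply: (@eval_word_inj m); [by rewrite /= le_i | by rewrite /= le_j |].
  by rewrite -xiu -xjv.
rewrite xiu -(@peq_eval m (i :: complement i j ++ w)); last 2 first.
- by rewrite -uw.
- rewrite /= le_i -(peq_all _ uw) //.
rewrite -cat_cons eval_word_cat; apply: divides_mull; exists w => //.
by move: lu; rewrite (peq_all _ uw) all_cat => /andP [].
Qed.

Lemma lcm_sigmaC i j : i <= m -> j <= m -> lcm_sigma i j = lcm_sigma j i.
Proof.
move=> le_i le_j; apply: peq_eval; first exact: PeqRel.
rewrite /= le_i /complement; case: (i == j) => //=.
by case: adjacent; rewrite /= le_j ?le_i.
Qed.

Lemma sigma_divides_lcm i j : i <= m -> j <= m -> divides (sigma i) (lcm_sigma i j).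
Proof. by move=> ? ?; apply: divides_mull; exact: positive_complement. Qed.

(* If a generator a divides x and y, the greatest common divisor is g a, where g
   is that of x / a and y / a: another common generator b divides g a because
   lcm a b divides x and y, whence g a is also the divisor obtained from b. *)
Lemma exists_gcd x y : positive x -> positive y ->
  exists2 g, positive g &
    forall d, positive d -> (divides d x /\ divides d y) <-> divides d g.
Proof.
have [N] := ubnP `|len x|%N; elim: N x y => // N IHN x y le_N px py.
have lower i : i <= m -> divides (sigma i) x -> divides (sigma i) y ->
    exists2 g, positive g & forall d, positive d ->
      (divides d (x * (sigma i)^-1) /\ divides d (y * (sigma i)^-1)) <-> divides d g.
  move=> le_i ix iy; apply: IHN => //; rewrite lenM lenV len_sigma.
  by have := divides_len ix; rewrite len_sigma; lia.
case: (pselect (exists i, [/\ i <= m, divides (sigma i) x & divides (sigma i) y]));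
  last first.
  move=> no_atom; exists 1; first exact: positive1.
  move=> d pd; split=> [[dx dy]|d1]; last first.
    by split; apply: (divides_trans d1); apply: divides1.
  case: (positive_case pd) => [->|[i [e [le_i pe de]]]]; first exact: divides_refl.
  case: no_atom; exists i; split=> //.
    by apply: divides_trans dx; rewrite de; apply: divides_mull.
  by apply: divides_trans dy; rewrite de; apply: divides_mull.
move=> [a [le_a ax ay]]; have [g pg gP] := lower a le_a ax ay.
have [gx gy] := (gP g pg).2 (divides_refl g).
have to_x h w : divides h (w * (sigma a)^-1) -> divides (h * sigma a) w.
  by move/(divides_mulr (sigma a)); rewrite mulgKV.
exists (g * sigma a); first by apply: positiveM => //; exact: positive_sigma.
move=> d pd; split=> [[dx dy]|d1]; last first.
  by split; apply: (divides_trans d1); apply: to_x.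
case: (positive_case pd) => [->|[b [e [le_b pe de]]]].
  by apply/divides1/positiveM => //; exact: positive_sigma.
have bd : divides (sigma b) d by rewrite de; exact: divides_mull.
have bx := divides_trans bd dx; have by_ := divides_trans bd dy.
have bga : divides (sigma b) (g * sigma a).
  apply: (@divides_trans (lcm_sigma a b)).
    by rewrite lcm_sigmaC //; exact: sigma_divides_lcm.
  apply: divides_mulr; apply/gP; first exact: positive_complement.
  by split; apply: divides_mulrV; exact: divides_lcm_sigma.
have [h ph hP] := lower b le_b bx by_.
have [hx hy] := (hP h ph).2 (divides_refl h).
have hb w : divides h (w * (sigma b)^-1) -> divides (h * sigma b) w.
  by move/(divides_mulr (sigma b)); rewrite mulgKV.
have ahb : divides (sigma a) (h * sigma b).
  apply: (@divides_trans (lcm_sigma b a)).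
    by rewrite lcm_sigmaC //; exact: sigma_divides_lcm.
  apply: divides_mulr; apply/hP; first exact: positive_complement.
  by split; apply: divides_mulrV; exact: divides_lcm_sigma.
have hga : divides (h * sigma b * (sigma a)^-1) g.
  by apply/gP => //; split; apply: divides_mulrV; rewrite mulgKV; apply: hb.
apply: (@divides_trans (h * sigma b)).
  rewrite de; apply: divides_mulr; apply/hP => //.
  by split; apply: divides_mulrV; rewrite -de.
by move/(divides_mulr (sigma a)): hga; rewrite mulgKV.
Qed.

End Divisibility.

(** * The center *)

Section Center.
Variable m : nat.
Local Notation B := (braid m.+2).
Local Notation letters := (all (fun i => i <= m)).
Local Notation sigma := (@sigma m).
Local Notation eval_word := (@eval_word m).
Local Notation positive := (@positive m).
Local Notation divides := (@divides m).
Local Notation len := (@len m).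
Local Open Scope group_scope.

Definition twist : B := eval_word (full_twist m).

Lemma sigmaE (i : 'I_(m.+2).-1) : sigma i = \pi_(braid m.+2) [:: (i, true)].
Proof. by rewrite /sigma; congr (\pi [:: (_, _)]); apply: val_inj; rewrite /= inordK. Qed.

Lemma sigmaVE (i : 'I_(m.+2).-1) : (sigma i)^-1 = \pi_(braid m.+2) [:: (i, false)].
Proof.
by apply: (mulgI (sigma i)); rewrite mulgV sigmaE piM; apply/esym/eq_piP/BraidCancel.
Qed.

Lemma commute_sigma_central (z : B) :
  (forall i, i <= m -> sigma i * z = z * sigma i) -> central z.
Proof.
move=> comm; apply/centralP => x; have [u ->] := braid_rep x.
elim: u => [|[i b] u IHu].
  by rewrite -[\pi_(braid m.+2) [::]]/(1 : B) mulg1 mul1g.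
rewrite -cat1s -piM -mulgA IHu !mulgA; congr (_ * _).
have le_i := letter_le i; case: b; first by rewrite -sigmaE comm.
by rewrite -sigmaVE; apply: (mulgI (sigma i)); rewrite mulKVg !mulgA comm // mulgK.
Qed.

Lemma central_twist : central twist.
Proof.
apply: commute_sigma_central => i le_i.
have -> : sigma i * twist = eval_word (full_twist m ++ [:: i]).
  by rewrite eval_word_cat /= mul1g.
rewrite (peq_eval (full_twist_letter le_i)) //.
by rewrite all_cat delta_pow_letters /= le_i.
Qed.

Lemma twist_quotientE i : i <= m -> eval_word (twist_quotient m i) = twist * (sigma i)^-1.
Proof.
move=> le_i; rewrite /twist -(peq_eval (twist_quotientl le_i)) /= ?mulgK //.
by rewrite le_i twist_quotient_letters.
Qed.

Lemma positive_twist : positive twist.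
Proof. by exists (full_twist m) => //; exact: delta_pow_letters. Qed.

Lemma positive_twistX k : positive (twist ^+ k).
Proof.
elim: k => [|k IHk]; first exact: positive1.
by rewrite expgS; apply: positiveM => //; exact: positive_twist.
Qed.

Lemma centralX (G : groupType) (z : G) k : central z -> central (z ^+ k).
Proof.
by move=> cz; elim: k => [|k IHk]; rewrite ?expg0 ?expgS ?central1 ?centralM.
Qed.

Lemma exists_positive (x : B) : exists k, positive (twist ^+ k * x).
Proof.
have [u ->] := braid_rep x; exists (twist_count u).
exists (clear_denominators u); first exact: clear_denominators_letters.
elim: u => [|[i b] u IHu] /=; first by rewrite mul1g.
rewrite eval_word_cat -IHu -cat1s -piM !mulgA; congr (_ * _).
have /centralP cz : central (twist ^+ twist_count u) by apply/centralX/central_twist.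
case: b; rewrite /= ?add1n ?add0n -?sigmaE -?sigmaVE.
  by rewrite mul1g cz.
rewrite twist_quotientE ?letter_le // expgS -!mulgA; congr (_ * _).
by rewrite cz.
Qed.

Lemma positive_mul_twist x k l : k <= l -> positive (twist ^+ k * x) -> positive (twist ^+ l * x).
Proof.
move=> le_kl pk; rewrite -(subnK le_kl) expgnDr -mulgA.
by apply: positiveM => //; exact: positive_twistX.
Qed.

Lemma sigma_divides_twist i : i <= m -> divides (sigma i) twist.
Proof.
move=> le_i; rewrite /divides -twist_quotientE //.
by exists (twist_quotient m i) => //; exact: twist_quotient_letters.
Qed.

(** The full twist is a common multiple, so there is one of minimal length. Its greatest common
    divisor with any other common multiple is again a common multiple, hence equal to it by
    minimality. *)
Lemma exists_lcm (S : {set 'I_m.+1}) : exists2 d, positive d &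
  forall x, positive x -> (forall i, i \in S -> divides (sigma i) x) <-> divides d x.
Proof.
pose common x := positive x /\ forall i, i \in S -> divides (sigma i) x.
have ex : exists k, `[< exists2 x, common x & len x = Posz k >].
  have [u _ /(congr1 len)] := positive_twist; rewrite len_eval => lz.
  exists (size u); apply/asboolP; exists twist => //; split; first exact: positive_twist.
  by move=> i _; apply: sigma_divides_twist; rewrite -ltnS.
have [k /asboolP [d [pd dP] ld] mink] := ex_minnP ex.
exists d => // x px; split=> [xP | dx i iS]; last exact: divides_trans (dP _ iS) dx.
have [g pg gP] := exists_gcd pd px.
have [gd gx] := (gP g pg).2 (divides_refl g).
suff -> : d = g by [].
apply: divides_eq => //; have := divides_len gd.
have /asboolP/mink : exists2 y, common y & len y = Posz `|len g|.
  exists g; last by have := positive_len_ge0 pg; lia.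
  split=> // i iS; have pi : positive (sigma i) by apply: positive_sigma; rewrite -ltnS.
  by apply/gP => //; split; [exact: dP | exact: xP].
have := positive_len_ge0 pg; rewrite ld; lia.
Qed.

Definition quasicentral (y : B) :=
  forall i, i <= m -> exists2 j, j <= m & y * sigma i = sigma j * y.

(* If s divides y and t is adjacent to s, then s and t divide y t = t' y, so t s t
   does and y = c t s; conjugating by s as well shows that t divides y. *)
Lemma quasicentral_all_divide y : positive y -> quasicentral y -> y <> 1 ->
  forall i, i <= m -> divides (sigma i) y.
Proof.
move=> py qy ny; case: (positive_case py) => [//|[i0 [y0 [le0 py0 yE]]]].
have div0 : divides (sigma i0) y by rewrite yE; exact: divides_mull.
have step s t : s <= m -> t <= m -> adjacent s t -> divides (sigma s) y -> divides (sigma t) y.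
  move=> le_s le_t adj sy.
  have adj' : adjacent t s by rewrite adjacentC.
  have [t' le_t' tE] := qy t le_t; have [s' le_s' sE] := qy s le_s.
  have sytt : divides (sigma s) (y * sigma t).
    by rewrite tE; apply: (divides_trans sy); apply/divides_mull/positive_sigma.
  have tyt : divides (sigma t) (y * sigma t) by apply: divides_mull.
  have := divides_lcm_sigma le_t le_s tyt sytt.
  rewrite /lcm_sigma complement_adj //= mul1g; set c := sigma t * _ * _ => cy.
  have yc : y = y * sigma t * c^-1 * sigma t * sigma s.
    by rewrite /c !invMg !mulgA mulgK !mulgKV.
  have : y * sigma t * c^-1 * sigma t * sigma s = sigma s' * (y * sigma t * c^-1 * sigma t).
    apply: (mulIg (sigma s)); rewrite -[LHS]/((_ * sigma s) * sigma s) -{1}yc sE.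
    by rewrite {1}yc !mulgA.
  rewrite -yc => ->; rewrite !mulgA; apply: divides_mull.
  by rewrite -!(mulgA (sigma s')); apply: positiveM => //; exact: positive_sigma.
have up k : i0 + k <= m -> divides (sigma (i0 + k)) y.
  elim: k => [|k IHk] le_k; first by rewrite addn0.
  apply: (step (i0 + k)); [lia | lia | rewrite /adjacent; lia | apply: IHk; lia].
have down k : k <= i0 -> divides (sigma (i0 - k)) y.
  elim: k => [|k IHk] le_k; first by rewrite subn0.
  apply: (step (i0 - k)); [lia | lia | rewrite /adjacent; lia | apply: IHk; lia].
move=> i le_i; case: (leqP i i0) => [le|lt].
  by have := down (i0 - i); rewrite subKn //; apply; rewrite leq_subr.
by have := up (i - i0); rewrite subnKC ?(ltnW lt) //; apply.
Qed.

Lemma sigma_len1 a : positive a -> len a = 1%R -> exists2 j, j <= m & a = sigma j.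
Proof.
move=> [[|j [|k u]] lu ->]; rewrite len_eval //= => _.
by exists j; [case/andP: lu | rewrite mul1g].
Qed.

(* The greatest common divisor g of x and y is quasicentral, so x / g and y / g
   are too; if they were not 1, every generator would divide both of them. *)
Lemma central_positive_eq x y : positive x -> positive y -> central x -> central y ->
  len x = len y -> x = y.
Proof.
move=> px py /centralP cx /centralP cy lxy.
have [g pg gP] := exists_gcd px py.
have [gx gy] := (gP g pg).2 (divides_refl g).
have mul_ok w i : (forall x, x * w = w * x) -> i <= m -> divides g w ->
    divides g (w * sigma i).
  move=> cw le_i gw; rewrite -cw.
  by apply: (divides_trans gw); apply/divides_mull/positive_sigma.
have qg i : i <= m -> exists2 j, j <= m & g * sigma i = sigma j * g.
  move=> le_i; have pi := positive_sigma le_i.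
  (* By centrality [g] divides both products, hence [h]; and [h] divides [g * sigma i]. So the
     conjugate of [sigma i] by [g] is positive of length 1, a generator. *)
  have [h ph hP] := exists_gcd (positiveM px pi) (positiveM py pi).
  have [hx hy] := (hP h ph).2 (divides_refl h).
  have gh : divides g h by apply/hP => //; split; apply: mul_ok.
  have ih : divides (sigma i) h by apply/hP => //; split; apply: divides_mull.
  have hg : divides h (g * sigma i).
    suff : divides (h * (sigma i)^-1) g by move/(divides_mulr (sigma i)); rewrite mulgKV.
    apply/gP => //; split; first by rewrite -(mulgK (sigma i) x); apply: divides_mulr.
    by rewrite -(mulgK (sigma i) y); apply: divides_mulr.
  have [|j le_j jE] := sigma_len1 (divides_trans gh hg).
    by rewrite !lenM lenV len_sigma; lia.
  by exists j; rewrite // -jE mulgKV.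
have qV w : (forall x, x * w = w * x) -> quasicentral (w * g^-1).
  move=> cw.
  (* Conjugation by the inverse of [g] must preserve the generators too. Conjugation by [g] is
     injective on the finite set of generators, hence a permutation; that distinct letters are
     distinct braids comes from the embedding. *)
  have ex (i : 'I_m.+1) : exists j : 'I_m.+1, g * sigma i = sigma j * g.
    have [j le_j jE] := qg i (ltn_ord i); have lt_j : j < m.+1 by [].
    by exists (Ordinal lt_j).
  pose p i := projT1 (cid (ex i)).
  have pE (i : 'I_m.+1) : g * sigma i = sigma (p i) * g := projT2 (cid (ex i)).
  have p_inj : injective p.
    move=> i j pij; have : sigma i = sigma j :> B.
      by apply: (mulgI g); rewrite !pE pij.
    move=> e; apply: val_inj => /=; have := @eval_word_inj m [:: val i] [:: val j].
    rewrite /= e !andbT => /(_ (ltn_ord i) (ltn_ord j) erefl) /peq_all all_eq.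
    by have := all_eq (pred1 (val i)); rewrite /= eqxx !andbT => /esym /eqP.
  move=> j le_j; have lt_j : j < m.+1 by [].
  have /codomP [i jE] : Ordinal lt_j \in codom p by by rewrite (inj_card_onto p_inj).
  exists (val i); first exact: (ltn_ord i).
  have -> : sigma j = g * sigma i * g^-1 by rewrite pE -jE mulgK.
  by rewrite !mulgA mulgKV cw.
have neq1 w : positive w -> divides g w -> w * g^-1 <> 1 -> (forall x, x * w = w * x) ->
    divides (sigma 0 * g) w.
  move=> pw gw nw cw; rewrite /divides invMg mulgA.
  exact: (quasicentral_all_divide gw (qV w cw) nw).
have [xg|nx] := pselect (x * g^-1 = 1).
  have ex : x = g by rewrite -(mulgKV g x) xg mul1g.
  by rewrite ex; apply/esym/divides_eq; rewrite // -lxy ex.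
have [yg|ny] := pselect (y * g^-1 = 1).
  have ey : y = g by rewrite -(mulgKV g y) yg mul1g.
  by rewrite ey; apply: divides_eq; rewrite // lxy ey.
have : divides (sigma 0 * g) g.
  apply/gP; last by split; apply: neq1.
  by apply: positiveM => //; exact: positive_sigma.
by move/divides_len; rewrite lenM len_sigma; lia.
Qed.

(** A power of the twist makes [x] positive, and the product is compared with that power itself. *)
Lemma central_len0 x : central x -> len x = 0%R -> x = 1.
Proof.
move=> cx lx; have [k pk] := exists_positive x.
have cz : central (twist ^+ k) by apply/centralX/central_twist.
apply: (mulgI (twist ^+ k)); rewrite mulg1; apply: central_positive_eq => //.
- exact: positive_twistX.
- exact: centralM.
- by rewrite lenM lx addr0.
Qed.

Lemma lenX x k : len (x ^+ k) = (len x *+ k)%R.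
Proof.
by elim: k => [|k IHk]; rewrite ?expg0 ?mulr0n ?len1 // expgS lenM IHk mulrS.
Qed.

(** By [central_len0] the length embeds the center into the integers, so a central element of least
    positive length generates it. The two natural exponents encode an integral one. *)
Theorem center_cyclic : exists z : B,
  [/\ central z, (0 < len z)%R &
    forall x, central x -> exists a b, x = z ^+ a * (z ^+ b)^-1].
Proof.
pose P k := `[< exists2 z, central z & len z = Posz k.+1 >].
have exP : exists k, P k.
  have l_twist : (0 < len twist)%R.
    have := divides_len (sigma_divides_twist (leq0n m)); rewrite len_sigma; lia.
  exists `|len twist|.-1; apply/asboolP; exists twist; first exact: central_twist.
  lia.
have [k /asboolP [z cz lz] mink] := ex_minnP exP.
exists z; split; [by [] | by rewrite lz |].
have pow_nat x : central x -> (0 <= len x)%R -> exists a, x = z ^+ a.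
  move=> cx ge0; exists (`|len x| %/ k.+1).
  set q := _ %/ _.
  have lr : len (x * (z ^+ q)^-1) = Posz (`|len x| %% k.+1).
    rewrite lenM lenV lenX lz -mulr_natr.
    by have := divn_eq `|len x| k.+1; rewrite -/q; lia.
  have cr : central (x * (z ^+ q)^-1) by apply/centralM/centralV/centralX.
  have : x * (z ^+ q)^-1 = 1.
    apply: central_len0 => //; rewrite lr; case E : (_ %% _) => [//|r].
    have /mink : P r by apply/asboolP; exists (x * (z ^+ q)^-1); rewrite // lr E.
    by have := ltn_mod `|len x| k.+1; rewrite E; lia.
  by move/(congr1 (fun y => y * z ^+ q)); rewrite mulgKV mul1g.
move=> x cx; have [ge0|lt0] := boolP (0 <= len x)%R.
  by have [a ->] := pow_nat x cx ge0; exists a, 0; rewrite expg0 invg1 mulg1.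
have [|b xE] := pow_nat x^-1 (centralV cx); first by rewrite lenV; lia.
by exists 0, b; rewrite expg0 mul1g -xE invgK.
Qed.

End Center.

(** * Matrix factorizations *)

Section MatrixFactorization.
Local Open Scope ring_scope.
Variables (R : nzRingType) (N : nat) (deg : 'I_N -> nat).
Variables (D : 'M[R]_N) (aug_cycle : 'rV[R]_N -> Prop).
Implicit Types (A F K E h : 'M[R]_N) (v u : 'rV[R]_N).

(** Row vectors form a free left module with differential [v *m D]; [aug_cycle] stands for the
    kernel of the augmentation in degree 0. *)
Definition homogeneous p v := forall j, v 0 j != 0 -> deg j = p.
Definition raises r A := forall i j, A i j != 0 -> deg j = (deg i + r)%N.

Lemma mulmx_neq0 m n p (A : 'M[R]_(m, n)) (B : 'M[R]_(n, p)) i j :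
  (A *m B) i j != 0 -> exists l, A i l != 0 /\ B l j != 0.
Proof.
rewrite mxE => AB; apply/not_existsP => none; case/eqP: AB.
apply: big1 => l _; have [->|nA] := eqVneq (A i l) 0; first by rewrite mul0r.
have [->|nB] := eqVneq (B l j) 0; first by rewrite mulr0.
by case: (none l).
Qed.

Lemma addmx_neq0 m n (A B : 'M[R]_(m, n)) i j :
  (A + B) i j != 0 -> A i j != 0 \/ B i j != 0.
Proof.
rewrite mxE; have [->|] := eqVneq (A i j) 0; first by rewrite add0r; right.
by left.
Qed.

Lemma oppmx_neq0 m n (A : 'M[R]_(m, n)) i j : ((- A) i j != 0) = (A i j != 0).
Proof. by rewrite mxE oppr_eq0. Qed.

Hypothesis D_lowers : forall i j, D i j != 0 -> deg i = (deg j).+1.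
Hypothesis D_sqr : D *m D = 0.
Hypothesis lift_cycle : forall p v, homogeneous p v -> v *m D = 0 ->
  (p = 0%N -> aug_cycle v) -> exists2 u, homogeneous p.+1 u & u *m D = v.

Lemma row_eq_mul p i A B : deg i = p ->
  (forall j, (deg j < p)%N -> row j A = row j B) -> row i (D *m A) = row i (D *m B).
Proof.
move=> deg_i eqAB; rewrite !row_mul; apply/rowP => j; rewrite !mxE; apply: eq_bigr => l _.
have [->|nD] := eqVneq (row i D 0 l) 0; first by rewrite !mul0r.
congr (_ * _); have := eqAB l; rewrite mxE in nD; have := D_lowers nD.
by move=> dl /(_ _)/rowP/(_ j); rewrite !mxE; apply; lia.
Qed.

(** The comparison argument for a free exact complex: [h] is built row by row, by increasing degree,
    lifting cycles through [D]. The augmentation matters only for rows that stay in degree 0. *)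
Lemma null_homotopy r F : raises r F -> D *m F = F *m D ->
  (r = 0%N -> forall i, deg i = 0%N -> aug_cycle (row i F)) ->
  exists2 h, raises r.+1 h & h *m D + D *m h = F.
Proof.
move=> F_raises DF augF.
suff [h h_raises hP] : exists2 h, raises r.+1 h &
    forall i, (deg i < (\max_i deg i).+1)%N -> row i (h *m D + D *m h) = row i F.
  by exists h => //; apply/row_matrixP => i; apply: hP; rewrite ltnS leq_bigmax.
elim: (\max_i deg i).+1 => [|p [h h_raises hP]].
  by exists 0 => // i j; rewrite mxE eqxx.
have lift i : exists u, deg i = p -> homogeneous (p + r).+1 u /\
    u *m D = row i (F - D *m h).
  have [deg_i|] := eqVneq (deg i) p; last by move/eqP=> neq; exists 0.
  have [|||u u_hom uD] := @lift_cycle (p + r) (row i (F - D *m h)).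
  - move=> j; rewrite mxE => /addmx_neq0 [/F_raises->|]; first by rewrite deg_i.
    rewrite oppmx_neq0 => /mulmx_neq0 [l [/D_lowers + /h_raises]]; lia.
  (* The row is a cycle: F D - D h D = D (F - h D), where in lower degrees F - h D is already D h,
     which D kills. *)
  - rewrite -row_mul mulmxBl -DF -mulmxA -mulmxBr.
    rewrite (@row_eq_mul p _ _ (D *m h)) // ?mulmxA ?D_sqr ?mul0mx ?row0 // => j /hP.
    by rewrite !linearB !linearD /= => <-; rewrite addrAC subrr add0r.
  - move=> /eqP; rewrite addn_eq0 => /andP [/eqP p0 /eqP r0].
    rewrite linearB /= row_mul; have -> : row i D = 0.
      apply/rowP => j; rewrite !mxE; apply/eqP/negPn/negP => /D_lowers.
      by rewrite deg_i p0.
    by rewrite mul0mx subr0; apply: augF; rewrite // deg_i.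
  by exists u.
have [u uP] := choice lift.
pose h' := \matrix_i (if deg i == p then u i else row i h).
have rowh' i : row i h' = if deg i == p then u i else row i h by rewrite rowK.
exists h' => [i j|i].
  have -> : h' i j = row i h' 0 j by rewrite [RHS]mxE.
  rewrite rowh'; case: (deg i =P p) => [deg_i /(uP i deg_i).1 ->|_]; first by rewrite deg_i addnS.
  by rewrite mxE => /h_raises.
have eqDh k : k = deg i -> (k <= p)%N -> row i (D *m h') = row i (D *m h).
  move=> -> le_p; apply: (@row_eq_mul (deg i)) => // l lt_l.
  by rewrite rowh' ltn_eqF //; lia.
rewrite ltnS leq_eqVlt => /orP [/eqP deg_i|lt_p].
  rewrite linearD /= (eqDh (deg i)) ?deg_i // [row i (h' *m D)]row_mul rowh' deg_i eqxx (uP i deg_i).2.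
  by rewrite linearB /= subrK.
rewrite -hP // !linearD /= (eqDh (deg i)) ?(ltnW lt_p) // [row i (h' *m D)]row_mul rowh'.
by rewrite ltn_eqF // !row_mul.
Qed.

Variable w : R.
Hypothesis w_central : forall x, x * w = w * x.
Hypothesis w_aug : forall i, deg i = 0%N -> aug_cycle (row i w%:M).

Lemma scalar_central_mx A : A *m w%:M = w%:M *m A.
Proof.
rewrite mul_scalar_mx; apply/matrixP => i j; rewrite !mxE (bigD1 j) //= !mxE eqxx.
rewrite mulr1n big1 ?addr0 // => l /negPf ne_l.
by rewrite !mxE ne_l mulr0n mulr0.
Qed.

(* H ^ 2 - w commutes with H, so its part of lowest degree is a chain map for D;
   a null-homotopy of this part is added to H, starting from H = D. *)
Lemma matrix_factorization : exists H : 'M[R]_N,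
  [/\ H *m H = w%:M,
      forall i j, H i j != 0 -> (deg i <= (deg j).+1)%N /\ odd (deg i) != odd (deg j) &
      forall i j, deg i = (deg j).+1 -> H i j = D i j].
Proof.
have D_odd i j : D i j != 0 -> odd (deg i) != odd (deg j).
  by move/D_lowers->; rewrite /=; case: odd.
(* Once the bound is generalized to [k], the clause on [K = 0] says that the induction starts at H =
   D. There the error is -w, whose homotopy requires [w_aug]. At the final bound no entry can raise
   the degree so much, so the error is 0. *)
suff [K [K_raises _ E_raises]] : exists K,
    [/\ forall i j, K i j != 0 -> (deg i < deg j)%N /\ odd (deg i) != odd (deg j),
        (\max_i deg i).+1 = 0%N -> K = 0 &
        forall i j, ((D + K) *m (D + K) - w%:M) i j != 0 ->
          (deg i + (\max_i deg i).+1.*2 <= deg j)%N].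
  exists (D + K); split.
  - apply/subr0_eq/matrixP => i j; rewrite [RHS]mxE; apply/eqP/negPn/negP => /E_raises.
    have : (deg j <= \max_i deg i)%N by exact: leq_bigmax.
    lia.
  - move=> i j /addmx_neq0 [nD|/K_raises [lt odd_ij]]; last by split=> //; lia.
    by split; [rewrite (D_lowers nD) | exact: D_odd].
  - move=> i j deg_i; rewrite mxE.
    suff -> : K i j = 0 by rewrite addr0.
    by apply/eqP/negPn/negP => /K_raises []; lia.
elim: _.+1 => [|k [K [K_raises K0 E_raises]]].
  exists 0; split=> // [i j|i j]; first by rewrite mxE eqxx.
  rewrite addr0 D_sqr sub0r oppmx_neq0 mxE; have [->|_] := eqVneq i j; first by rewrite addn0.
  by rewrite mulr0n eqxx.
set H := D + K in E_raises; set E := _ - _ in E_raises.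
have H_odd i j : H i j != 0 -> odd (deg i) != odd (deg j).
  by move/addmx_neq0 => [/D_odd|/K_raises []].
have E_even i j : E i j != 0 -> odd (deg i) = odd (deg j).
  move/addmx_neq0 => [/mulmx_neq0 [l [/H_odd il /H_odd lj]]|].
    by move: il lj; do 3!case: odd.
  rewrite oppmx_neq0 mxE; have [->//|_] := eqVneq i j.
  by rewrite mulr0n eqxx.
have HE : H *m E = E *m H.
  by rewrite mulmxBl mulmxBr scalar_central_mx mulmxA.
pose Ek := \matrix_(i, j) (if deg j == (deg i + k.*2)%N then E i j else 0).
have Ek_raises i j : Ek i j != 0 -> deg j = (deg i + k.*2)%N.
  by rewrite mxE; case: (deg j =P (deg i + k.*2)%N) => // _; rewrite eqxx.
have EkE i j : deg j = (deg i + k.*2)%N -> Ek i j = E i j.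
  by move=> deg_j; rewrite mxE deg_j eqxx.
(* Compare in H E = E H the entries raising the degree by 2k - 1; those of K E and E K raise it
   further. *)
have DEk : D *m Ek = Ek *m D.
  apply/matrixP => i j; have [deg_j|neq_deg] := eqVneq (deg j).+1 (deg i + k.*2)%N.
    have -> : (D *m Ek) i j = (H *m E) i j.
      rewrite mulmxDl [RHS]mxE.
      have -> : (K *m E) i j = 0.
        apply/eqP/negPn/negP => /mulmx_neq0 [l [/K_raises [lt _] /E_raises]]; lia.
      rewrite addr0 !mxE; apply: eq_bigr => l _.
      have [->|/D_lowers deg_i] := eqVneq (D i l) 0; first by rewrite !mul0r.
      by rewrite EkE //; lia.
    rewrite HE mulmxDr [LHS]mxE.
    have -> : (E *m K) i j = 0.
      apply/eqP/negPn/negP => /mulmx_neq0 [l [/E_raises + /K_raises [+ _]]]; lia.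
    rewrite addr0 !mxE; apply: eq_bigr => l _.
    have [->|/D_lowers deg_l] := eqVneq (D l j) 0; first by rewrite !mulr0.
    by rewrite EkE //; lia.
  have -> : (D *m Ek) i j = 0.
    apply/eqP/negPn/negP => /mulmx_neq0 [l [/D_lowers + /Ek_raises]].
    by move/eqP: neq_deg; lia.
  apply/esym/eqP/negPn/negP => /mulmx_neq0 [l [/Ek_raises + /D_lowers]].
  by move/eqP: neq_deg; lia.
have [|||h h_raises hP] := @null_homotopy k.*2 (- Ek).
- by move=> i j; rewrite oppmx_neq0 => /Ek_raises.
- by rewrite mulmxN mulNmx DEk.
- move=> k0 i deg_i; have {}k0 : k = 0%N by lia.
  have -> : row i (- Ek) = row i w%:M; last exact: w_aug.
  have E0 : E = - w%:M by rewrite /E /H K0 // addr0 D_sqr sub0r.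
  apply/rowP => j; rewrite /Ek E0 !mxE k0 double0 addn0.
  have [->|neq] := eqVneq i j; first by rewrite eqxx opprK.
  by rewrite mulr0n oppr0; case: eqP; rewrite oppr0.
exists (K + h); split=> // [i j /addmx_neq0 [/K_raises//|/h_raises ->]|i j].
  by rewrite oddD /= odd_double; split; [lia | case: odd].
(* D h + h D cancels [Ek]. By parity the rest of E raises the degree by at least 2k + 2; so do the
   products, as K raises it by at least 1 and h by 2k + 1. *)
have -> : (D + (K + h)) *m (D + (K + h)) - w%:M =
    (E - Ek) + (K *m h + h *m K + h *m h).
  have Hh : H *m h = D *m h + K *m h by rewrite mulmxDl.
  have hH : h *m H = h *m D + h *m K by rewrite mulmxDr.
  have expand A : (A + h) *m (A + h) = A *m A + A *m h + (h *m A + h *m h).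
    by rewrite mulmxDl !mulmxDr.
  by rewrite -hP addrA -/H expand Hh hH /E !addrA [LHS](ACl (1*7*4*2*3*5*6)).
move/addmx_neq0 => [|/addmx_neq0 [/addmx_neq0 [|]|]].
- rewrite [(E - Ek) i j]mxE [(- Ek) i j]mxE [Ek i j]mxE.
  case: (deg j =P (deg i + k.*2)%N) => [_|neq]; first by rewrite subrr eqxx.
  rewrite subr0 => nE; have := E_raises _ _ nE; have := E_even _ _ nE.
  by move: neq; lia.
- by move/mulmx_neq0 => [l [/K_raises [+ _] /h_raises]]; lia.
- by move/mulmx_neq0 => [l [/h_raises + /K_raises [+ _]]]; lia.
- by move/mulmx_neq0 => [l [/h_raises + /h_raises]]; lia.
Qed.
End MatrixFactorization.

(** * Chains on a simplex *)

Section Simplex.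
Local Open Scope ring_scope.
Variable n : nat.
Implicit Types (S T : {set 'I_n}) (i j : 'I_n) (c : {set 'I_n} -> int).

Definition sign_at i S : int := (-1) ^+ #|[set j in S | (j < i)%N]|.

Lemma sign_at_sqr i S : sign_at i S * sign_at i S = 1.
Proof. by rewrite -expr2 sqrr_sign. Qed.

Lemma sign_atU i j S : i \notin S -> sign_at j (i |: S) = (-1) ^+ (i < j)%N * sign_at j S.
Proof.
move=> iS; rewrite /sign_at -exprD; congr (_ ^+ _).
case: ltnP => [lt|ge].
  have -> : [set k in i |: S | (k < j)%N] = i |: [set k in S | (k < j)%N].
    by apply/setP => k; rewrite !inE; case: eqP => [->|//]; rewrite lt.
  by rewrite cardsU1 inE (negPf iS).
have -> // : [set k in i |: S | (k < j)%N] = [set k in S | (k < j)%N].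
apply/setP => k; rewrite !inE; case: eqP => [->|//].
by rewrite (negPf iS) ltnNge ge.
Qed.

Lemma sign_atU_self i S : sign_at i (i |: S) = sign_at i S.
Proof.
have [iS|iS] := boolP (i \in S); first by rewrite (setUidPr _) // sub1set.
by rewrite sign_atU // ltnn mul1r.
Qed.

(* A chain c = sum_S c_S [S] on the full simplex on 'I_n; face i sums the parts
   of the boundary omitting i, and cone i joins with the vertex i. *)
Definition face i c T := if i \in T then 0 else sign_at i T * c (i |: T).
Definition cone i c T := if i \in T then sign_at i T * c (T :\ i) else 0.
Definition boundary c T := \sum_i face i c T.

Lemma face_face i j c T : i != j -> face i (face j c) T = - face j (face i c) T.
Proof.
move=> neq; rewrite /face !inE (negPf neq) eq_sym (negPf neq) /=.
have [iT|iT] := boolP (i \in T); have [jT|jT] := boolP (j \in T);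
  rewrite ?mulr0 ?oppr0 //.
rewrite !sign_atU // setUCA.
case: (ltngtP i j) => [_|_|/val_inj eq]; last by rewrite eq eqxx in neq.
  by rewrite expr1 expr0; ring.
by rewrite expr1 expr0; ring.
Qed.

(** [face] and [cone] are contraction and multiplication in the exterior algebra on the vertices;
    this lemma and its neighbors are their anticommutation relations. *)
Lemma face_cone i c T : face i (cone i c) T + cone i (face i c) T = c T.
Proof.
rewrite /face /cone; have [iT|iT] := boolP (i \in T).
  rewrite !inE eqxx /= setD1K // add0r mulrA -[X in sign_at i X](setD1K iT).
  by rewrite sign_atU_self sign_at_sqr mul1r.
by rewrite !inE eqxx /= setU1K // addr0 mulrA sign_atU_self sign_at_sqr mul1r.
Qed.

Lemma face_cone_neq i j c T : i != j -> face j (cone i c) T = - cone i (face j c) T.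
Proof.
move=> neq; rewrite /face /cone !inE (negPf neq) /=.
have [jT|jT] := boolP (j \in T).
  by rewrite eq_sym neq /=; case: ifP; rewrite ?mulr0 oppr0.
rewrite ?andbF.
have [iT|iT] := boolP (i \in T); last by rewrite mulr0 oppr0.
have -> : (j |: T) :\ i = j |: T :\ i.
  apply/setP => k; rewrite !inE; case: (k =P j) => [->|//]; by rewrite eq_sym neq.
rewrite sign_atU // -{1}(setD1K iT) [sign_at j (i |: _)]sign_atU ?inE ?eqxx //.
case: (ltngtP i j) => [_|_|/val_inj eq]; last by rewrite eq eqxx in neq.
  by rewrite expr1 expr0; ring.
by rewrite expr1 expr0; ring.
Qed.

Lemma face_sum I (r : seq I) i (f : I -> {set 'I_n} -> int) T :
  face i (fun T => \sum_(k <- r) f k T) T = \sum_(k <- r) face i (f k) T.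
Proof. by rewrite /face; case: ifP => _; [rewrite big1 | rewrite mulr_sumr]. Qed.

Lemma cone_sum I (r : seq I) i (f : I -> {set 'I_n} -> int) T :
  cone i (fun T => \sum_(k <- r) f k T) T = \sum_(k <- r) cone i (f k) T.
Proof. by rewrite /cone; case: ifP => _; [rewrite mulr_sumr | rewrite big1]. Qed.

Lemma boundary_boundary c T : boundary (boundary c) T = 0.
Proof.
have dd : boundary (boundary c) T = \sum_i \sum_j face i (face j c) T.
  by apply: eq_bigr => i _; exact: (face_sum _ _ (fun j => face j c)).
suff : boundary (boundary c) T = - boundary (boundary c) T by lia.
rewrite dd {1}exchange_big -sumrN /=; apply: eq_bigr => i _.
rewrite -sumrN; apply: eq_bigr => j _.
have [->|neq] := eqVneq i j; last by rewrite face_face // eq_sym.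
by rewrite /face !inE eqxx /=; case: ifP; rewrite ?mulr0 oppr0.
Qed.

(** The empty simplex counts as a cell, so this contraction holds in every degree. *)
Lemma boundary_cone i c T : boundary (cone i c) T + cone i (boundary c) T = c T.
Proof.
rewrite (cone_sum _ _ (fun j => face j c)) -big_split /= (bigD1 i) //= face_cone big1 ?addr0 // => j neq.
by rewrite face_cone_neq 1?eq_sym // addNr.
Qed.

End Simplex.

(** * Vectors over a group ring *)

Section GroupRingTheory.
Local Open Scope ring_scope.
Variable G : groupType.
Implicit Types (x y g : G) (a b : group_ring G).

Lemma group_ringME a b :
  a * b = \sum_(x <- msupp a) \sum_(y <- msupp b) << a@_x * b@_y *g (x * y)%g >>.
Proof. by []. Qed.

Lemma group_ringUU (k l : int) x y :
  (<< k *g x >> : group_ring G) * << l *g y >> = << k * l *g (x * y)%g >>.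
Proof. exact: group_ring_mulUU. Qed.

Lemma sum_neq0 (V : zmodType) (I : eqType) (r : seq I) (F : I -> V) :
  \sum_(i <- r) F i != 0 -> exists2 i, i \in r & F i != 0.
Proof.
move=> nF; apply/not_exists2P => none; case/eqP: nF.
rewrite big_seq big1 // => i ir; apply/eqP/negPn/negP => nFi.
by case: (none i).
Qed.

Lemma mcoeff_gsum (I : Type) (r : seq I) (P : pred I) (F : I -> group_ring G) x :
  (\sum_(i <- r | P i) F i)@_x = \sum_(i <- r | P i) (F i)@_x.
Proof. exact: raddf_sum. Qed.

Lemma mcoeffM_neq0 a b x : (a * b)@_x != 0 ->
  exists y1 y2, [/\ a@_y1 != 0, b@_y2 != 0 & x = (y1 * y2)%g].
Proof.
rewrite group_ringME mcoeff_gsum => /sum_neq0 [y1 y1a].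
rewrite mcoeff_gsum => /sum_neq0 [y2 y2b]; rewrite mcoeffU => nz.
exists y1, y2; rewrite !mcoeff_neq0 y1a y2b; split=> //.
by move: nz; case: ((y1 * y2)%g =P x) => [->//|_]; rewrite mulr0n eqxx.
Qed.

Lemma mcoeffD_neq0 a b x : (a + b)@_x != 0 -> a@_x != 0 \/ b@_x != 0.
Proof.
rewrite mcoeffD; have [->|] := eqVneq (a@_x) 0; first by rewrite add0r; right.
by left.
Qed.

Lemma augmentation0 : augmentation (0 : group_ring G) = 0.
Proof. by apply: (addrI (augmentation (0 : group_ring G))); rewrite -augmentationD !addr0. Qed.

Lemma augmentationN a : augmentation (- a) = - augmentation a.
Proof. by apply: (addrI (augmentation a)); rewrite -augmentationD !subrr augmentation0. Qed.

Lemma mcoeffMz a (k : int) x : (a * k%:~R)@_x = a@_x * k.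
Proof.
rewrite mulrzr -mulrzz.
exact: (raddfMz (mcoeff x : {additive group_ring G -> int})).
Qed.

Lemma augmentationMz a (k : int) : augmentation (a * k%:~R) = augmentation a * k.
Proof.
rewrite augmentationM; congr (_ * _).
have -> : (k%:~R : group_ring G) = << k *g 1%g >>; last exact: augmentationU.
by apply/malgP => x; rewrite -[k%:~R]mul1r mcoeffMz !mcoeffU mulrnAl mul1r.
Qed.

End GroupRingTheory.

(** * Vectors as families of chains indexed by the group *)

Section Coefficients.
Local Open Scope ring_scope.
Variables (G : groupType) (n : nat).
Local Notation R := (group_ring G).
Local Notation N := #|{set 'I_n}|.

Definition cell (a : 'I_N) : {set 'I_n} := enum_val a.
Definition dim (a : 'I_N) : nat := #|cell a|.
Definition coef (v : 'rV[R]_N) (x : G) (T : {set 'I_n}) : int := (v 0 (enum_rank T))@_x.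

Definition simplex_mx : 'M[R]_N :=
  \matrix_(a, b) (boundary (fun S => (S == cell a)%:R) (cell b))%:~R.

Lemma boundary_sum I (r : seq I) (f : I -> {set 'I_n} -> int) T :
  boundary (fun T => \sum_(k <- r) f k T) T = \sum_(k <- r) boundary (f k) T.
Proof.
rewrite /boundary [RHS]exchange_big; apply: eq_bigr => i _; exact: face_sum.
Qed.

Lemma boundaryZ (k : int) (c : {set 'I_n} -> int) T :
  boundary (fun T => k * c T) T = k * boundary c T.
Proof.
rewrite /boundary mulr_sumr; apply: eq_bigr => i _.
by rewrite /face; case: ifP; rewrite ?mulr0 // mulrCA.
Qed.

Lemma eq_boundary (c c' : {set 'I_n} -> int) : c =1 c' -> boundary c =1 boundary c'.
Proof. by move=> /funext ->. Qed.

(** The matrix has integer entries, so it does not move the group element: it acts separately on the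
    chain at each [x]. *)
Lemma coef_simplex_mx v x T : coef (v *m simplex_mx) x T = boundary (coef v x) T.
Proof.
rewrite /coef mxE mcoeff_gsum.
have cE : coef v x =1 fun S => \sum_a (v 0 a)@_x * (S == cell a)%:R.
  move=> S; rewrite (bigD1 (enum_rank S)) //= /cell enum_rankK eqxx mulr1.
  rewrite big1 ?addr0 // => a ne; case: (S =P enum_val a) => [e|_]; last exact: mulr0.
  by rewrite e enum_valK eqxx in ne.
rewrite (eq_boundary cE) boundary_sum; apply: eq_bigr => a _.
by rewrite mxE mcoeffMz /cell enum_rankK boundaryZ.
Qed.

Lemma coefP v w : (forall x T, coef v x T = coef w x T) -> v = w.
Proof.
move=> eq_vw; apply/rowP => a; apply/malgP => x.
by have := eq_vw x (enum_val a); rewrite /coef enum_valK.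
Qed.

Lemma coefD v w x T : coef (v + w) x T = coef v x T + coef w x T.
Proof. by rewrite /coef mxE mcoeffD. Qed.

Lemma coefN v x T : coef (- v) x T = - coef v x T.
Proof. by rewrite /coef mxE mcoeffN. Qed.

Lemma coef0 x T : coef 0 x T = 0.
Proof. by rewrite /coef mxE mcoeff0. Qed.

Lemma simplex_mx_sqr : simplex_mx *m simplex_mx = 0.
Proof.
apply/row_matrixP => a; rewrite row_mul row0; apply: coefP => x T.
rewrite coef_simplex_mx coef0 -(boundary_boundary (coef (row a 1%:M) x) T).
by apply: eq_boundary => S; rewrite -coef_simplex_mx -row_mul mul1mx.
Qed.

Lemma simplex_mx_neq0 a b : simplex_mx a b != 0 ->
  exists2 i, i \notin cell b & cell a = i |: cell b.
Proof.
rewrite mxE => nz; have : boundary (fun S => (S == cell a)%:R) (cell b) != 0.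
  by apply: contraNneq nz => ->.
rewrite /boundary => /sum_neq0 [i _]; rewrite /face.
case: ifP => [_|ib]; first by rewrite eqxx.
case: (i |: cell b =P cell a) => [e _|_]; last by rewrite mulr0 eqxx.
by exists i; rewrite ?ib.
Qed.

Lemma simplex_mx_dim a b : simplex_mx a b != 0 -> dim a = (dim b).+1.
Proof.
by move=> /simplex_mx_neq0 [i ib e]; rewrite /dim e cardsU1 ib.
Qed.

End Coefficients.

(** * The complex over the group ring of the braid group *)

Section LatticeComplex.
Local Open Scope ring_scope.
Variables (G : groupType) (m : nat) (s : 'I_m.+1 -> G) (pos : G -> Prop) (len : G -> int).
Variable lcm : {set 'I_m.+1} -> G.
Local Notation R := (group_ring G).
Local Notation N := #|{set 'I_m.+1}|.
Local Notation dim := (@dim m.+1).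
Local Notation D0 := (@simplex_mx G m.+1).
Implicit Types (v u : 'rV[R]_N) (x y : G) (i : 'I_m.+1).

Hypothesis pos1 : pos 1%g.
Hypothesis posM : forall x y, pos x -> pos y -> pos (x * y)%g.
Hypothesis lenM : forall x y, len (x * y)%g = len x + len y.
Hypothesis pos_len : forall x, pos x -> 0 <= len x.
Hypothesis pos_len0 : forall x, pos x -> len x = 0 -> x = 1%g.
Hypothesis len_s : forall i, len (s i) = 1.
Hypothesis pos_atom : forall x, pos x -> x <> 1%g -> exists i, pos (x * (s i)^-1)%g.
Hypothesis pos_lcm : forall S, pos (lcm S).
Hypothesis lcmP : forall (S : {set 'I_m.+1}) x, pos x ->
  (forall i, i \in S -> pos (x * (s i)^-1)%g) <-> pos (x * (lcm S)^-1)%g.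

(* The vectors, over the monoid ring of pos, generated by lcm S times the basis
   vector of S, with supports of length less than q. In this basis the leading
   part of the differential has the constant coefficients of simplex_mx. *)
Definition in_lattice (q : nat) v := forall a x, (v 0 a)@_x != 0 ->
  [/\ pos x, len x < q%:Z & forall i, i \in cell a -> pos (x * (s i)^-1)%g].

Lemma len_one : len 1%g = 0.
Proof. by apply: (addrI (len 1%g)); rewrite -lenM mulg1 addr0. Qed.

Lemma len_inv x : len x^-1%g = - len x.
Proof. by apply: (addrI (len x)); rewrite -lenM mulgV len_one subrr. Qed.

Lemma in_lattice0 v : in_lattice 0 v -> v = 0.
Proof.
move=> L; apply/rowP => a; apply/malgP => x; rewrite mxE mcoeff0.
apply/eqP/negPn/negP => /L [/pos_len]; lia.
Qed.

Lemma in_latticeD q v u : in_lattice q v -> in_lattice q u -> in_lattice q (v + u).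
Proof. by move=> Lv Lu a x; rewrite mxE => /mcoeffD_neq0 [/Lv|/Lu]. Qed.

Lemma in_latticeN q v : in_lattice q v -> in_lattice q (- v).
Proof. by move=> Lv a x; rewrite mxE mcoeffN oppr_eq0 => /Lv. Qed.

Lemma in_lattice_zero q : in_lattice q 0.
Proof. by move=> a x; rewrite mxE mcoeff0 eqxx. Qed.

Lemma in_latticeW q r v : (q <= r)%N -> in_lattice q v -> in_lattice r v.
Proof. by move=> le_qr Lv a x /Lv [? ? ?]; split=> //; lia. Qed.

Lemma in_lattice_simplex q v : in_lattice q v -> in_lattice q (v *m D0).
Proof.
move=> Lv b x; rewrite mxE mcoeff_gsum => /sum_neq0 [a _ nz].
have nD : D0 a b != 0 by apply: contraNneq nz => ->; rewrite mulr0 mcoeff0.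
have [|px lx sx] := Lv a x.
  by apply: contraNneq nz => va; rewrite mxE mcoeffMz va mul0r.
split=> // i ib; apply: sx.
by have [j _ ->] := simplex_mx_neq0 nD; rewrite inE ib orbT.
Qed.

(* The part of v of length q + 1 at a group element x <> 1 is a chain on the
   simplex of the generators dividing x, so it is the boundary of a cone. *)
Lemma simplex_lift p q v : in_lattice q.+2 v -> homogeneous dim p v ->
  (forall x T, len x = q.+1%:Z -> coef (v *m D0) x T = 0) ->
  exists b, [/\ in_lattice q.+2 b, homogeneous dim p.+1 b & in_lattice q.+1 (v - b *m D0)].
Proof.
move=> Lv hv vD0.
have exi x : exists i, pos x -> x <> 1%g -> pos (x * (s i)^-1)%g.
  have [[px nx]|nP] := pselect (pos x /\ x <> 1%g).
    by have [i xi] := pos_atom px nx; exists i.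
  by exists ord0 => px nx; case: nP.
have [top topP] := choice exi.
(* The finitely many elements of top length in the support of [v]; only their chains are coned
   off. *)
pose X := [seq x <- undup (flatten [seq msupp (v 0 a) : seq G | a <- enum 'I_N]) |
           len x == q.+1%:Z].
have Xuniq : uniq X by rewrite filter_uniq // undup_uniq.
pose b : 'rV[R]_N := \row_a \sum_(x <- X) << cone (top x) (coef v x) (cell a) *g x >>.
have coef_b x T : coef b x T = if len x == q.+1%:Z then cone (top x) (coef v x) T else 0.
  rewrite /coef mxE mcoeff_gsum /cell enum_rankK.
  under eq_bigr => y _ do rewrite mcoeffU.
  have [xX|xX] := boolP (x \in X).
    rewrite (bigD1_seq x) //= eqxx mulr1n big1 ?addr0; last first.
      by move=> y /negPf ->; rewrite mulr0n.
    by move: xX; rewrite mem_filter => /andP [->].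
  rewrite big_seq big1; last first.
    move=> y yX; case: eqP => [e|_]; last by rewrite mulr0n.
    by rewrite e (negPf xX) in yX.
  case: ifP => // lx; rewrite /cone; case: ifP => // _.
  rewrite /coef [X in _ = _ * X](_ : _ = 0) ?mulr0 //.
  apply/eqP/negPn/negP; rewrite mcoeff_neq0 => xv; case/negP: xX.
  rewrite mem_filter lx mem_undup; apply/flattenP.
  by exists (msupp (v 0 (enum_rank (T :\ top x))) : seq G) => //; apply: map_f; rewrite mem_enum.
have b_neq0 a x : (b 0 a)@_x != 0 ->
    [/\ len x = q.+1%:Z, top x \in cell a & coef v x (cell a :\ top x) != 0].
  have -> : (b 0 a)@_x = coef b x (cell a) by rewrite /coef /cell enum_valK.
  rewrite coef_b; case: (len x =P _) => [lx|_]; last by rewrite eqxx.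
  rewrite /cone; case: ifP => [ta|_]; last by rewrite eqxx.
  by rewrite mulf_eq0 negb_or => /andP [_ nz].
have Lb : in_lattice q.+2 b.
  move=> a x /b_neq0 [lx ta /Lv [px _ sx]]; split=> //; first by rewrite lx; lia.
  move=> i ia; have [->|ne] := eqVneq i (top x).
    by apply: topP => // x1; move: lx; rewrite x1 len_one.
  by apply: sx; rewrite /cell enum_rankK !inE ne.
exists b; split=> //.
  move=> a nb; have [x] : exists x, (b 0 a)@_x != 0.
    apply/not_existsP => none; case/eqP: nb; apply/malgP => x.
    by rewrite mcoeff0; apply/eqP/negPn/negP/none.
  move=> /b_neq0 [_ ta nz].
  have /hv : v 0 (enum_rank (cell a :\ top x)) != 0.
    by apply: contraNneq nz => v0; rewrite /coef v0 mcoeff0.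
  by rewrite /dim /cell enum_rankK (cardsD1 (top x) (enum_val a)) ta => ->.
have Lvb : in_lattice q.+2 (v - b *m D0).
  exact/in_latticeD/in_latticeN/in_lattice_simplex.
move=> a x nz; have [px lx sx] := Lvb a x nz; split=> //.
suff : len x <> q.+1%:Z by lia.
move=> lxq; case/eqP: nz; rewrite -[a]enum_valK -/(coef _ x (enum_val a)).
rewrite coefD coefN coef_simplex_mx.
have -> : boundary (coef b x) (enum_val a) = boundary (cone (top x) (coef v x)) (enum_val a).
  by apply: eq_boundary => T; rewrite coef_b lxq eqxx.
rewrite -{1}(boundary_cone (top x) (coef v x)) addrC addKr /cone.
by case: ifP => // _; rewrite -coef_simplex_mx vD0 ?mulr0.
Qed.

Section LiftCycles.
Variables (D : 'M[R]_N) (p : nat).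
Local Notation i0 := (enum_rank (set0 : {set 'I_m.+1})).
Hypothesis D_sqr : D *m D = 0.
Hypothesis D_dim : forall a b, D a b != 0 -> dim a = (dim b).+1.
Hypothesis D_aug : forall a, augmentation (D a i0) = 0.
Hypothesis D_lower : forall r q v, (r <= p.+1)%N -> in_lattice q v -> homogeneous dim r v ->
  in_lattice q.-1 (v *m (D - D0)).

Lemma augmentation_mulmx v : augmentation ((v *m D) 0 i0) = 0.
Proof.
rewrite mxE augmentation_sum big1 // => a _.
by rewrite augmentationM D_aug mulr0.
Qed.

Lemma homogeneous_mul r v : homogeneous dim r.+1 v -> homogeneous dim r (v *m D).
Proof. by move=> hv b /mulmx_neq0 [a [/hv da /D_dim]]; rewrite da => -[]. Qed.

(** Descent on the length: at top length [v] is a cycle for [D0], hence there the boundary of some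
    [b], and v - b D is a shorter cycle. The descent ends at length 0, where the augmentation
    decides. *)
Lemma lift_lattice_cycle q v : in_lattice q v -> homogeneous dim p v -> v *m D = 0 ->
  (p = 0%N -> augmentation (v 0 i0) = 0) ->
  exists u, [/\ in_lattice q u, homogeneous dim p.+1 u & u *m D = v].
Proof.
case: q => [|q]; first move=> /in_lattice0 ->.
  move=> _ _ _; exists 0; rewrite mul0mx; split=> //; first exact: in_lattice_zero.
  by move=> j; rewrite mxE eqxx.
elim: q v => [|q IHq] v Lv hv vD augv.
  (* Length below 1 leaves only x = 1, which no generator divides, so only the empty cell
     remains. *)
  have v_supp a x : (v 0 a)@_x != 0 -> x = 1%g /\ a = i0.
    move=> /Lv [px lx sx]; have x1 : x = 1%g.
      by apply: pos_len0 => //; have := pos_len px; lia.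
    split=> //; rewrite -[a]enum_valK; congr enum_rank.
    apply/setP => i; rewrite inE; apply/negP => /sx /pos_len.
    by rewrite x1 mul1g len_inv len_s.
  suff -> : v = 0.
    exists 0; rewrite mul0mx; split=> //; first exact: in_lattice_zero.
    by move=> j; rewrite mxE eqxx.
  apply/rowP => a; apply/malgP => x; rewrite mxE mcoeff0.
  apply/eqP/negPn/negP => nz; have [x1 a0] := v_supp _ _ nz.
  have va : v 0 a = << (v 0 a)@_x *g x >>.
    apply/malgP => y; rewrite mcoeffU; case: (x =P y) => [->//|ne].
    rewrite mulr0n; apply/eqP/negPn/negP => /v_supp [y1 _].
    by case: ne; rewrite x1 y1.
  have va0 : v 0 a != 0 by apply: contraNneq nz => ->; rewrite mcoeff0.
  case/eqP: nz; rewrite -[LHS](augmentationU _ x) -va a0; apply: augv.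
  by rewrite -(hv _ va0) a0 /dim /cell enum_rankK cards0.
have [|b [Lb hb Lvb]] := simplex_lift Lv hv.
  move=> x T lx.
  have -> : v *m D0 = - (v *m (D - D0)) by rewrite mulmxBr vD sub0r opprK.
  rewrite coefN /coef; apply/eqP; rewrite oppr_eq0; apply/negPn/negP.
  by move/(D_lower (leqnSn p) Lv hv) => [_ + _]; rewrite lx; lia.
have [||||u [Lu hu uD]] := IHq (v - b *m D).
- have -> : v - b *m D = (v - b *m D0) - b *m (D - D0).
    by rewrite mulmxBr opprB addrA subrK.
  by apply: in_latticeD => //; apply/in_latticeN; exact: (D_lower (leqnn p.+1) Lb hb).
- by move=> a /addmx_neq0 [/hv//|]; rewrite oppmx_neq0 => /(homogeneous_mul hb).
- by rewrite mulmxBl vD -mulmxA D_sqr mulmx0 subrr.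
- move=> p0; rewrite !mxE augmentationD augmentationN augv // sub0r.
  by have := augmentation_mulmx b; rewrite mxE => ->; rewrite oppr0.
exists (u + b); split.
- by apply: in_latticeD => //; apply: in_latticeW Lu.
- by move=> a /addmx_neq0 [/hu|/hb].
- by rewrite mulmxDl uD subrK.
Qed.
End LiftCycles.

Local Notation i0 := (enum_rank (set0 : {set 'I_m.+1})).

Lemma mcoeff_intr (k : int) x : (k%:~R : R)@_x != 0 -> x = 1%g.
Proof.
rewrite -[k%:~R]mul1r mcoeffMz mcoeffU; case: (1%g =P x) => [->//|_].
by rewrite mulr0n mul0r eqxx.
Qed.

Lemma homogeneous0_mul (D : 'M[R]_N) v :
  (forall a b, D a b != 0 -> dim a = (dim b).+1) -> homogeneous dim 0 v -> v *m D = 0.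
Proof.
move=> D_dim hv; apply/rowP => b; rewrite [RHS]mxE; apply/eqP/negPn/negP.
by move=> /mulmx_neq0 [a [/hv da /D_dim]]; rewrite da.
Qed.

Lemma dim_i0 : dim i0 = 0%N.
Proof. by rewrite /dim /cell enum_rankK cards0. Qed.

Lemma dim0 a : dim a = 0%N -> a = i0.
Proof. by move/eqP; rewrite cards_eq0 /cell => /eqP <-; rewrite enum_valK. Qed.

Lemma pos_lcm_div (S : {set 'I_m.+1}) i : i \in S -> pos (lcm S * (s i)^-1)%g.
Proof. by apply: ((lcmP S (pos_lcm S)).2 _ i); rewrite mulgV. Qed.

(* The row of a cell S of dimension k + 1 is t - u divided by lcm S, where t is
   lcm S times the simplicial boundary of S and u, of lower length, has the
   same image as t. *)
Lemma lattice_differential k : exists D : 'M[R]_N,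
  [/\ forall a b, D a b != 0 -> dim a = (dim b).+1 /\ (dim a <= k)%N,
      D *m D = 0, forall a, augmentation (D a i0) = 0 &
      forall r q v, (r <= k)%N -> in_lattice q v -> homogeneous dim r v ->
        in_lattice q.-1 (v *m (D - D0))].
Proof.
elim: k => [|k [D [D_supp D_sqr D_aug D_lower]]].
  exists 0; split=> [a b||a|r q v]; rewrite ?mxE ?eqxx ?mul0mx ?augmentation0 //.
  rewrite leqn0 sub0r mulmxN => /eqP -> Lv hv; rewrite homogeneous0_mul // ?oppr0.
    exact: in_lattice_zero.
  exact: simplex_mx_dim.
have D_dim a b : D a b != 0 -> dim a = (dim b).+1 by case/D_supp.
pose t a := (<< lcm (cell a) >> : R) *: row a D0.
have t_neq0 a b : t a 0 b != 0 -> D0 a b != 0.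
  by rewrite !mxE -/(D0 a b); apply: contraNneq => ->; rewrite mulr0.
have t_hom a : dim a = k.+1 -> homogeneous dim k (t a).
  by move=> da b /t_neq0/simplex_mx_dim; rewrite da => -[].
have t_lattice a : in_lattice `|len (lcm (cell a))|.+1 (t a).
  move=> b x nz; have nD : D0 a b != 0.
    by apply: t_neq0; apply: contraNneq nz => ->; rewrite mcoeff0.
  move: nz; rewrite mxE [row a D0 0 b]mxE => /mcoeffM_neq0 [y1 [y2 [+ + ->]]].
  rewrite mcoeffU [D0 a b]mxE => nz1 /mcoeff_intr ->; rewrite mulg1.
  have <- : lcm (cell a) = y1.
    by apply/eqP; apply: contraNT nz1 => /negPf ->; rewrite mulr0n.
  split; [exact: pos_lcm | by have := pos_len (pos_lcm (cell a)); lia |].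
  move=> i ib; apply: pos_lcm_div.
  by have [j _ ->] := simplex_mx_neq0 nD; rewrite inE ib orbT.
have tD a : dim a = k.+1 -> in_lattice `|len (lcm (cell a))| (t a *m D).
  move=> da; have -> : t a *m D = t a *m (D - D0).
    by rewrite mulmxBr -(scalemxAl _ _ D0) -row_mul simplex_mx_sqr row0 scaler0 subr0.
  exact: (D_lower k _.+1 _ (leqnn k) (t_lattice a) (t_hom a da)).
(* In degree one [u] is the integer with the augmentation of [t a], placed at the group element 1;
   the row becomes an integer multiple of [1 - (lcm (cell a))^-1]. In higher degrees [t a *m D] is a
   cycle shorter than [t a], and it is lifted inside the lattice. *)
have correction a : exists u, dim a = k.+1 ->
    [/\ in_lattice `|len (lcm (cell a))| u, homogeneous dim k u, u *m D = t a *m D &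
        k = 0%N -> augmentation (u 0 i0) = augmentation (t a 0 i0)].
  have [da|//] := eqVneq (dim a) k.+1; last by move/eqP=> nd; exists 0.
  case: k D_supp D_lower t_hom da tD => [|k] D_supp D_lower t_hom da tD.
    exists ((augmentation (t a 0 i0))%:~R *: delta_mx 0 i0) => _.
    have u_neq0 b x : (((augmentation (t a 0 i0))%:~R *: delta_mx 0 i0 : 'rV[R]_N) 0 b)@_x != 0 ->
        b = i0 /\ x = 1%g.
      rewrite !mxE eqxx /=; case: (b =P i0) => [->|_].
        by rewrite mulr1 => /mcoeff_intr.
      by rewrite mulr0 mcoeff0 eqxx.
    have u_hom : homogeneous dim 0 ((augmentation (t a 0 i0))%:~R *: delta_mx 0 i0 : 'rV[R]_N).
      move=> b; rewrite !mxE eqxx /=; case: (b =P i0) => [->|_]; last by rewrite mulr0 eqxx.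
      by rewrite dim_i0.
    split.
    - move=> b x /u_neq0 [-> ->]; split; [exact: pos1 | | by move=> i; rewrite /cell enum_rankK inE].
      have /card_gt0P [i ia] : (0 < #|cell a|)%N by rewrite -/(dim a) da.
      have := pos_len (pos_lcm_div ia); rewrite lenM len_inv len_s len_one; lia.
    - exact: u_hom.
    - by rewrite (homogeneous0_mul D_dim u_hom) (homogeneous0_mul D_dim (t_hom a da)).
    - move=> _; rewrite [in LHS]mxE [delta_mx _ _ _ _]mxE !eqxx mulr1 -[_%:~R]mul1r.
      by rewrite augmentationMz augmentationU mul1r.
  have [|||u [Lu hu uD]] := lift_lattice_cycle D_sqr D_dim D_aug D_lower (tD a da).
  - by apply: homogeneous_mul => //; exact: t_hom.
  - by rewrite -mulmxA D_sqr mulmx0.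
  - by move=> _; exact: augmentation_mulmx.
  by exists u => _; split.
have [u uP] := choice correction.
pose D' := \matrix_a (if dim a == k.+1 then (<< (lcm (cell a))^-1%g >> : R) *: (t a - u a)
                     else row a D).
have rowD' a : row a D' = if dim a == k.+1 then (<< (lcm (cell a))^-1%g >> : R) *: (t a - u a)
                     else row a D by rewrite rowK.
have D'E a b : D' a b = row a D' 0 b by rewrite [RHS]mxE.
have tu_hom a : dim a = k.+1 -> homogeneous dim k (t a - u a).
  move=> da b /addmx_neq0 [/(t_hom a da)//|]; rewrite oppmx_neq0.
  by have [_ hu _ _] := uP a da; exact: hu.
have D'_supp a b : D' a b != 0 -> dim a = (dim b).+1 /\ (dim a <= k.+1)%N.
  rewrite D'E rowD'; case: (dim a =P k.+1) => [da|_].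
    rewrite mxE => nz; have /(tu_hom a da) : (t a - u a) 0 b != 0.
      by by apply: contraNneq nz => ->; rewrite mulr0.
    by rewrite da => ->.
  by rewrite mxE => /D_supp [? ?]; split=> //; exact: leqW.
have mulD' r v : (r <= k)%N -> homogeneous dim r v -> v *m D' = v *m D.
  move=> le_r hv; apply/rowP => b; rewrite !mxE; apply: eq_bigr => a _.
  have [->|/hv da] := eqVneq (v 0 a) 0; first by rewrite !mul0r.
  by rewrite D'E rowD' da ltn_eqF ?mxE // ltnS.
exists D'; split=> //.
- apply/row_matrixP => a; rewrite row_mul row0 rowD'; case: (dim a =P k.+1) => [da|nd].
    rewrite -scalemxAl (mulD' k) //; last exact: tu_hom.
    by have [_ _ uD _] := uP a da; rewrite mulmxBl uD subrr scaler0.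
  have [le_a|gt_a] := leqP (dim a) k.+1.
    rewrite (mulD' (dim a).-1); [|lia|].
      by rewrite -row_mul D_sqr row0.
    by move=> b; rewrite mxE => /D_dim ->.
  have -> : row a D = 0.
    by apply/rowP => b; rewrite !mxE; apply/eqP/negPn/negP => /D_supp [_]; lia.
  by rewrite mul0mx.
- move=> a; rewrite D'E rowD'; case: (dim a =P k.+1) => [da|_]; last by rewrite mxE.
  rewrite mxE augmentationM augmentationU mul1r mxE augmentationD [(- u a) 0 i0]mxE.
  rewrite augmentationN; have [_ hu _ u0] := uP a da.
  have [k0|nk] := eqVneq k 0%N; first by rewrite u0 // subrr.
  have zero v : homogeneous dim k v -> v 0 i0 = 0.
    move=> hv; apply/eqP/negPn/negP => /hv; rewrite dim_i0 => k0.
    by rewrite -k0 eqxx in nk.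
  by rewrite !zero ?augmentation0 ?subrr //; exact: t_hom.
move=> r q v; rewrite leq_eqVlt => /orP [/eqP ->|le_r] Lv hv; last first.
  by rewrite mulmxBr (mulD' r) // -mulmxBr; exact: (D_lower r).
move=> b x; rewrite mxE mcoeff_gsum => /sum_neq0 [a _].
have [->|va] := eqVneq (v 0 a) 0; first by rewrite mul0r mcoeff0 eqxx.
have da := hv a va; have -> : (D' - D0) a b = - ((<< (lcm (cell a))^-1%g >> : R) * u a 0 b).
  have -> : (D' - D0) a b = row a D' 0 b - D0 a b by rewrite -D'E !mxE.
  rewrite rowD' da eqxx mxE [(t a - u a) 0 b]mxE [(- u a) 0 b]mxE mulrDr mulrN.
  rewrite [t a 0 b]mxE mulrA group_ringUU mul1r mulVg [row a D0 0 b]mxE mul1r.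
  by rewrite addrAC subrr sub0r.
rewrite mulrN mcoeffN oppr_eq0 => /mcoeffM_neq0 [y1 [y' [ny1 + ->]]].
move=> /mcoeffM_neq0 [y2 [y3 [+ ny3 ->]]].
rewrite mcoeffU => ny2; have <- : (lcm (cell a))^-1%g = y2.
  by apply/eqP; apply: contraNT ny2 => /negPf ->; rewrite mulr0n.
have [py1 ly1 sy1] := Lv a y1 ny1; have [Lu _ _ _] := uP a da.
have [py3 ly3 sy3] := Lu b y3 ny3.
(* [y1] is a positive multiple of the lcm, and replacing the lcm by the strictly shorter [y3] lowers
   the length. *)
have py : pos (y1 * (lcm (cell a))^-1)%g by apply/lcmP.
have py_y3 := posM py py3; rewrite mulgA; split; first exact: py_y3.
  have := pos_len py; have := pos_len (pos_lcm (cell a)).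
  by rewrite !lenM len_inv; lia.
move=> i /sy3 pi; rewrite -(mulgA _ y3); exact: posM.
Qed.

Variable z : G.
Hypothesis pos_mulX : forall x, exists k0, forall k, (k0 <= k)%N -> pos (z ^+ k * x)%g.

(** The support is finite, so one power of [z] makes all of its elements positive and divisible by
    every generator. This factor is a unit of the group ring, so a lift found in the lattice can be
    divided by it. *)
Lemma eventually_in_lattice v : exists k0, forall k, (k0 <= k)%N ->
  exists q, in_lattice q ((<< (z ^+ k)%g >> : R) *: v).
Proof.
pose P (v : 'rV[R]_N) := exists k0, forall k, (k0 <= k)%N ->
  exists q, in_lattice q ((<< (z ^+ k)%g >> : R) *: v).
have P0 : P 0 by exists 0%N => k _; exists 0%N; rewrite scaler0; exact: in_lattice_zero.
have PD v1 v2 : P v1 -> P v2 -> P (v1 + v2).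
  move=> [k1 P1] [k2 P2]; exists (maxn k1 k2) => k; rewrite geq_max => /andP [le1 le2].
  have [q1 L1] := P1 k le1; have [q2 L2] := P2 k le2; exists (maxn q1 q2).
  rewrite scalerDr; apply: in_latticeD.
    exact: (in_latticeW (leq_maxl q1 q2) L1).
  exact: (in_latticeW (leq_maxr q1 q2) L2).
have Pmono (c : int) x a : P ((<< c *g x >> : R) *: delta_mx 0 a).
  have [k0 k0P] := choice pos_mulX.
  exists (maxn (k0 x) (\max_i k0 (x * (s i)^-1)%g)) => k; rewrite geq_max => /andP [le1 le2].
  exists `|len (z ^+ k * x)%g|.+1 => b y; rewrite scalerA group_ringUU mul1r !mxE eqxx /=.
  case: (b =P a) => [_|_]; last by rewrite mulr0 mcoeff0 eqxx.
  rewrite mulr1 mcoeffU; case: ((z ^+ k * x)%g =P y) => [<- _|_]; last by rewrite mulr0n eqxx.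
  split; [exact: k0P | by have := pos_len (k0P x k le1); lia | move=> i _].
  rewrite -mulgA; apply: k0P; apply: leq_trans le2.
  exact: (leq_bigmax (F := fun i => k0 (x * (s i)^-1)%g)).
have Pscale (c : R) a : P (c *: delta_mx 0 a).
  have -> : c = \sum_(x <- msupp c) << c@_x *g x >> by exact: monalgE.
  by rewrite scaler_suml; apply: (big_ind P) => [//|//|x _]; exact: Pmono.
have vE : v = \sum_a v 0 a *: delta_mx 0 a := row_sum_delta v.
suff : P v by [].
by rewrite vE; apply: (big_ind P) => [//|//|a _]; exact: Pscale.
Qed.

Theorem group_complex : exists D : 'M[R]_N,
  [/\ forall a b, D a b != 0 -> dim a = (dim b).+1, D *m D = 0,
      forall a, augmentation (D a i0) = 0 &
      forall p v, homogeneous dim p v -> v *m D = 0 ->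
        (p = 0%N -> augmentation (v 0 i0) = 0) ->
        exists2 u, homogeneous dim p.+1 u & u *m D = v].
Proof.
(* Cells have dimension at most m + 1; lifting a cycle of degree p uses [D_lower] up to degree p +
   1. *)
have [D [D_supp D_sqr D_aug D_lower]] := lattice_differential m.+2.
have D_dim a b : D a b != 0 -> dim a = (dim b).+1 by case/D_supp.
exists D; split=> // p v hv vD augv.
have [le_p|gt_p] := leqP p m.+1; last first.
  exists 0; first by move=> a; rewrite mxE eqxx.
  rewrite mul0mx; apply/rowP => a; rewrite mxE; apply/esym/eqP/negPn/negP => /hv da.
  by have := max_card (cell a); rewrite -/(dim a) da card_ord; lia.
have [k /(_ k (leqnn k)) [q Lq]] := eventually_in_lattice v.
have [||||u [Lu hu uD]] := @lift_lattice_cycle D p D_sqr D_dim D_aug _ q _ Lq.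
- by move=> r q' v' le_r; apply: D_lower; lia.
- move=> a; rewrite mxE => nz; apply: hv; by apply: contraNneq nz => ->; rewrite mulr0.
- by rewrite -scalemxAl vD scaler0.
- by move=> p0; rewrite mxE augmentationM augv // mulr0.
exists ((<< (z ^+ k)^-1%g >> : R) *: u).
  by move=> a; rewrite mxE => nz; apply: hu; by apply: contraNneq nz => ->; rewrite mulr0.
by rewrite -scalemxAl uD scalerA group_ringUU mul1r mulVg scale1r.
Qed.

End LatticeComplex.

(** * The periodic complex *)

Section RowBasis.
Local Open Scope ring_scope.
Variables (R : nzRingType) (d : nat).

Lemma row_basis : is_basis (fun k : 'I_d => delta_mx 0 k : 'rV[R]_d).
Proof.
have sumE (c : {fsfun 'I_d -> R with 0}) k :
    (\sum_(i <- finsupp c) c i *: delta_mx 0 i : 'rV[R]_d) 0 k = c k.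
  rewrite summxE; have [kc|kc] := boolP (k \in finsupp c).
    rewrite (bigD1_seq k kc (fset_uniq _)) /= big1 => [|i ne].
      by rewrite !mxE !eqxx mulr1 addr0.
    by rewrite !mxE eqxx /= eq_sym (negPf ne) mulr0.
  rewrite (fsfun_dflt kc) big_seq big1 // => i ic.
  rewrite !mxE eqxx /=; case: (k =P i) => [e|_]; last by rewrite mulr0.
  by rewrite e ic in kc.
move=> v; pose c : {fsfun 'I_d -> R with 0} := [fsfun i in [fset i in enum 'I_d]%fset => v 0 i].
have cE k : c k = v 0 k by rewrite fsfunE inE mem_enum.
exists c; split=> [|c' vE]; first by apply/rowP => k; rewrite sumE cE.
by apply/fsfunP => k; rewrite cE vE sumE.
Qed.

Lemma row_free_of_rank : is_free_of_rank d ('rV[R]_d).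
Proof. by exists (fun k => delta_mx 0 k); exact: row_basis. Qed.

Lemma row_is_free : is_free ('rV[R]_d).
Proof. by exists 'I_d, (fun k => delta_mx 0 k); exact: row_basis. Qed.

Lemma row_finitely_generated : finitely_generated ('rV[R]_d).
Proof.
exists d, (fun k => delta_mx 0 k) => v; exists (v 0); exact: row_sum_delta.
Qed.

End RowBasis.

Section PeriodicComplex.
Local Open Scope ring_scope.
Variables (R S : nzRingType) (pi : {rmorphism R -> S}) (w : R).
Hypothesis pi_surj : forall y, exists x, pi x = y.
Hypothesis pi_ker : forall a, pi a = 0 -> exists b, a = w * b.
Hypothesis pi_w : pi w = 0.
Hypothesis w_central : forall x, x * w = w * x.
Hypothesis w_reg : forall x, w * x = 0 -> x = 0.

Variables (N : nat) (deg : 'I_N -> nat) (D H : 'M[R]_N) (aug_cycle : 'rV[R]_N -> Prop).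
Hypothesis D_lowers : forall i j, D i j != 0 -> deg i = (deg j).+1.
Hypothesis lift_cycle : forall p v, homogeneous deg p v -> v *m D = 0 ->
  (p = 0%N -> aug_cycle v) -> exists2 u, homogeneous deg p.+1 u & u *m D = v.
Hypothesis H_sqr : H *m H = w%:M.
Hypothesis H_supp : forall i j, H i j != 0 ->
  (deg i <= (deg j).+1)%N /\ odd (deg i) != odd (deg j).
Hypothesis H_lead : forall i j, deg i = (deg j).+1 -> H i j = D i j.

Implicit Types (a b u : 'rV[R]_N) (P Q : {set 'I_N}).

Definition layer (j : nat) : {set 'I_N} := [set i | (deg i <= j)%N & odd (deg i) == odd j].
Definition reduced_mx P Q : 'M[S]_(#|P|, #|Q|) :=
  \matrix_(k, l) pi (H (enum_val k) (enum_val l)).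
Definition reduce Q a : 'rV[S]_#|Q| := \row_k pi (a 0 (enum_val k)).
Definition supported P a := forall i, a 0 i != 0 -> i \in P.
Definition restrict Q a : 'rV[R]_N := \row_i (if i \in Q then a 0 i else 0).

Lemma mem_layer j i : (i \in layer j) = (deg i <= j)%N && (odd (deg i) == odd j).
Proof. by rewrite inE. Qed.

Lemma reduce_surj P v : exists2 a, supported P a & reduce P a = v.
Proof.
have [lift liftP] := choice pi_surj.
exists (\sum_k lift (v 0 k) *: delta_mx 0 (enum_val k)).
  move=> i; rewrite summxE => nz; apply/negPn/negP => iP; case/eqP: nz.
  apply: big1 => k _; rewrite !mxE eqxx /=; case: eqP => [e|_]; last by rewrite mulr0.
  by rewrite e enum_valP in iP.
apply/rowP => k; rewrite mxE summxE (bigD1 k) //= big1 => [|l ne].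
  by rewrite !mxE !eqxx mulr1 addr0 liftP.
by rewrite !mxE eqxx /= (inj_eq enum_val_inj) eq_sym (negPf ne) mulr0.
Qed.

Lemma reduce_mul P Q a : supported P a ->
  reduce P a *m reduced_mx P Q = reduce Q (a *m H).
Proof.
move=> aP; apply/rowP => l; rewrite !mxE rmorph_sum /=.
rewrite (bigID [in P]) /= [X in _ = _ + X]big1 ?addr0; last first.
  move=> i iP; have -> : a 0 i = 0 by apply/eqP/negPn/negP => /aP; rewrite (negPf iP).
  by rewrite mul0r rmorph0.
rewrite [RHS]big_enum_val /=; apply: eq_bigr => k _; by rewrite !mxE rmorphM.
Qed.

Lemma eq_reduce Q a b : (forall i, i \in Q -> pi (a 0 i) = pi (b 0 i)) ->
  reduce Q a = reduce Q b.
Proof. by move=> eq_ab; apply/rowP => k; rewrite !mxE eq_ab ?enum_valP. Qed.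

Lemma reduce_eq0 Q a : reduce Q a = 0 -> forall i, i \in Q -> pi (a 0 i) = 0.
Proof.
by move=> /rowP a0 i iQ; have := a0 (enum_rank_in iQ i); rewrite !mxE enum_rankK_in.
Qed.

Lemma reduce_restrict Q a : reduce Q (restrict Q a) = reduce Q a.
Proof. by apply: eq_reduce => i iQ; rewrite mxE iQ. Qed.

Lemma restrict_supported Q a : supported Q (restrict Q a).
Proof. by move=> i; rewrite mxE; case: ifP => // _; rewrite eqxx. Qed.

Lemma mul_odd j a i : supported (layer j) a -> (a *m H) 0 i != 0 -> odd (deg i) = ~~ odd j.
Proof.
move=> aC /mulmx_neq0 [l [/aC + /H_supp [_]]]; rewrite mem_layer => /andP [_ /eqP ->].
by do 2!case: odd.
Qed.

(* Truncating to degrees at most j + 1 only discards terms whose image under H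
   has degree greater than j. *)
Lemma restrict_mul j a l : (deg l <= j)%N ->
  (forall i, a 0 i != 0 -> odd (deg i) = odd j.+1) ->
  (restrict (layer j.+1) a *m H) 0 l = (a *m H) 0 l.
Proof.
move=> le_l a_odd; rewrite !mxE; apply: eq_bigr => i _; rewrite mxE mem_layer.
have [->|/a_odd ->] := eqVneq (a 0 i) 0; first by case: ifP.
rewrite eqxx andbT; case: leqP => // gt_i.
have [->|/H_supp []] := eqVneq (H i l) 0; first by rewrite !mulr0.
by move=> le_i _; lia.
Qed.

Lemma mulHH a : a *m H *m H = w *: a.
Proof.
rewrite -mulmxA H_sqr; apply/rowP => i; rewrite !mxE (bigD1 i) //= !mxE eqxx mulr1n.
rewrite big1 ?addr0 // => l /negPf ne; by rewrite !mxE ne mulr0n mulr0.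
Qed.

Lemma reduce_differential_sqr j a : supported (layer j.+2) a ->
  reduce (layer j) (restrict (layer j.+1) (a *m H) *m H) = 0.
Proof.
move=> aC; apply/rowP => k; rewrite !mxE.
have := enum_valP k; rewrite mem_layer => /andP [le_k _].
have -> : \sum_i restrict (layer j.+1) (a *m H) 0 i * H i (enum_val k) =
  (restrict (layer j.+1) (a *m H) *m H) 0 (enum_val k) by rewrite [RHS]mxE.
rewrite restrict_mul //; last by move=> i /(mul_odd aC) ->; rewrite /= negbK.
by rewrite mulHH mxE rmorphM pi_w mul0r.
Qed.

(** On layer j, a H = w b for some b. Applying H again gives w a = w b H in degrees below j, so a =
    b H there by regularity of w. The difference is then concentrated in degree j + 1 and is a cycle
    for D; it lifts to some u of degree j + 2, and b + u is the required preimage. *)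
Lemma reduce_exact j a : supported (layer j.+1) a -> reduce (layer j) (a *m H) = 0 ->
  exists2 u, supported (layer j.+2) u & reduce (layer j.+1) (u *m H) = reduce (layer j.+1) a.
Proof.
move=> aC /reduce_eq0 aH0.
have exb i : exists x, i \in layer j -> (a *m H) 0 i = w * x.
  have [iC|niC] := boolP (i \in layer j); last by exists 0.
  by have [x xE] := pi_ker (aH0 i iC); exists x.
have [f fP] := choice exb.
pose b : 'rV[R]_N := \row_i (if i \in layer j then f i else 0).
have bC : supported (layer j) b.
  by move=> i; rewrite mxE; case: ifP => // _; rewrite eqxx.
have bP i : i \in layer j -> (a *m H) 0 i = w * b 0 i.
  by move=> iC; rewrite [b 0 i]mxE iC fP.
have b_low i : (deg i < j)%N -> odd (deg i) = odd j.+1 -> a 0 i = (b *m H) 0 i.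
  move=> lt_i odd_i; apply/subr0_eq/w_reg; rewrite mulrBr; apply/eqP; rewrite subr_eq0.
  have -> : w * a 0 i = (a *m H *m H) 0 i by rewrite mulHH mxE.
  rewrite mxE [in X in _ == w * X]mxE mulr_sumr; apply/eqP/eq_bigr => l _.
  have [->|/H_supp [le_l ne_l]] := eqVneq (H l i) 0; first by rewrite !mulr0.
  rewrite mulrA; congr (_ * _); apply: bP; rewrite mem_layer (leq_trans le_l) //=.
  by move: ne_l; rewrite odd_i /=; do 2!case: odd.
pose c := a - restrict (layer j.+1) (b *m H).
have c_hom : homogeneous deg j.+1 c.
  move=> i nz; have iC : i \in layer j.+1.
    by move: nz => /addmx_neq0 [/aC//|]; rewrite oppmx_neq0 => /restrict_supported.
  move: (iC); rewrite mem_layer leq_eqVlt => /andP [/orP [/eqP //|lt_i] /eqP odd_i].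
  have lt_i' : (deg i < j)%N.
    rewrite ltn_neqAle -ltnS lt_i andbT; apply/eqP => e.
    by move: odd_i; rewrite e /=; case: odd.
  by case/eqP: nz; rewrite mxE [(- _ : 'rV_N) 0 i]mxE mxE iC -b_low // subrr.
(* In degree j, c D agrees with c H = a H - b H^2 = w b - w b. *)
have cD : c *m D = 0.
  apply/rowP => l; rewrite [RHS]mxE; apply/eqP/negPn/negP => nz.
  have deg_l : deg l = j.
    by have [i [/c_hom di /D_lowers]] := mulmx_neq0 nz; rewrite di => -[].
  case/eqP: nz; have -> : (c *m D) 0 l = (c *m H) 0 l.
    rewrite !mxE; apply: eq_bigr => i _.
    have [->|/c_hom di] := eqVneq (c 0 i) 0; first by rewrite !mul0r.
    by rewrite H_lead // di deg_l.
  rewrite mulmxBl mxE [(- _ : 'rV_N) 0 l]mxE restrict_mul ?deg_l //; last first.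
    by move=> i /(mul_odd bC) ->.
  by rewrite mulHH bP ?mxE ?subrr // mem_layer deg_l leqnn eqxx.
have [//|u u_hom uD] := lift_cycle c_hom cD.
exists (b + u).
  move=> i /addmx_neq0 [/bC|/u_hom di]; rewrite !mem_layer.
    by move=> /andP [le_i /eqP ->] /=; rewrite negbK eqxx andbT; lia.
  by rewrite di leqnn eqxx.
apply: eq_reduce => i iC; congr (pi _); rewrite mulmxDl mxE.
(* H lowers degrees by at most one, so on this layer u H has only its leading part u D, in degree j
   + 1. *)
have -> : (u *m H) 0 i = c 0 i.
  move: (iC); rewrite mem_layer leq_eqVlt => /andP [/orP [/eqP di|lt_i] _].
    rewrite -uD !mxE; apply: eq_bigr => l _.
    have [->|/u_hom dl] := eqVneq (u 0 l) 0; first by rewrite !mul0r.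
    by rewrite H_lead // dl di.
  have -> : c 0 i = 0 by apply/eqP/negPn/negP => /c_hom; lia.
  apply/eqP/negPn/negP => /mulmx_neq0 [l [/u_hom dl /H_supp []]].
  by rewrite dl; lia.
have -> : c 0 i = a 0 i - (b *m H) 0 i.
  by rewrite /c mxE [(- _ : 'rV_N) 0 i]mxE [restrict _ _ _ _]mxE iC.
by rewrite addrC subrK.
Qed.

Lemma mul_lead u i : homogeneous deg 1 u -> deg i = 0%N -> (u *m H) 0 i = (u *m D) 0 i.
Proof.
move=> u_hom di; rewrite !mxE; apply: eq_bigr => l _.
have [->|/u_hom dl] := eqVneq (u 0 l) 0; first by rewrite !mul0r.
by rewrite H_lead // dl di.
Qed.

Lemma supported_layer0 a : supported (layer 0) a <-> homogeneous deg 0 a.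
Proof.
split=> aP i /aP; first by rewrite mem_layer leqn0 => /andP [/eqP].
by rewrite mem_layer => ->.
Qed.

Lemma supported_layer1 a : supported (layer 1) a <-> homogeneous deg 1 a.
Proof.
split=> aP i /aP; rewrite mem_layer; last by move=> ->.
by case: (deg i) => [|[|]].
Qed.

Lemma reduce_exact0 a : supported (layer 0) a -> aug_cycle a ->
  exists2 u, supported (layer 1) u & reduce (layer 0) (u *m H) = reduce (layer 0) a.
Proof.
move=> /supported_layer0 a_hom aug_a.
have [||u u_hom uD] := @lift_cycle 0 a a_hom; last 1 first.
- exists u; first exact/supported_layer1.
  apply: eq_reduce => i; rewrite mem_layer leqn0 => /andP [/eqP di _].
  by rewrite mul_lead // uD.
- apply/rowP => j; rewrite [RHS]mxE; apply/eqP/negPn/negP => /mulmx_neq0 [l [/a_hom dl /D_lowers]].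
  by rewrite dl.
- by [].
Qed.

Lemma layer_periodic n j : (forall i, (deg i <= n)%N) -> (n <= j)%N -> layer j.+2 = layer j.
Proof.
move=> deg_le le_j; apply/setP => i; rewrite !mem_layer /= negbK.
have le_ij := leq_trans (deg_le i) le_j.
by rewrite le_ij (leq_trans le_ij) // ltnW.
Qed.

Variables (A : lmodType S) (eps : {linear 'rV[S]_#|layer 0| -> A}).
Hypothesis eps_surj : forall k, exists x, eps x = k.
Hypothesis eps_ker : forall a, supported (layer 0) a ->
  eps (reduce (layer 0) a) = 0 <-> aug_cycle a.
Hypothesis aug_cycle_mul : forall u, aug_cycle (u *m D).

Definition periodic_map P Q : {linear 'rV[S]_#|P| -> 'rV[S]_#|Q|} :=
  mulmxr (reduced_mx P Q).

Lemma periodic_map_reduce P Q a : supported P a ->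
  periodic_map P Q (reduce P a) = reduce Q (a *m H).
Proof. exact: reduce_mul. Qed.

Lemma periodic_exact0 x :
  eps x = 0 <-> exists y, periodic_map (layer 1) (layer 0) y = x.
Proof.
have [a aC <-] := reduce_surj x; rewrite eps_ker //; split=> [aug_a|[y]].
  have [u uC uH] := reduce_exact0 aC aug_a.
  by exists (reduce (layer 1) u); rewrite periodic_map_reduce.
have [u uC <-] := reduce_surj y; rewrite periodic_map_reduce // => ua.
apply/(eps_ker aC); rewrite -ua.
have /supported_layer1 u_hom := uC.
have -> : reduce (layer 0) (u *m H) = reduce (layer 0) (u *m D).
  apply: eq_reduce => i; rewrite mem_layer leqn0 => /andP [/eqP di _].
  by rewrite mul_lead.
apply/eps_ker; last exact: aug_cycle_mul.
apply/supported_layer0 => i /mulmx_neq0 [l [/u_hom dl /D_lowers]].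
by rewrite dl => -[].
Qed.

Lemma periodic_exactS j x : periodic_map (layer j.+1) (layer j) x = 0 <->
  exists y, periodic_map (layer j.+2) (layer j.+1) y = x.
Proof.
have [a aC <-] := reduce_surj x; rewrite periodic_map_reduce //; split=> [|[y]].
  move=> /(reduce_exact aC) [u uC uH].
  by exists (reduce (layer j.+2) u); rewrite periodic_map_reduce.
have [u uC <-] := reduce_surj y; rewrite periodic_map_reduce // -reduce_restrict => ua.
rewrite -(periodic_map_reduce _ aC) -ua periodic_map_reduce.
  exact: reduce_differential_sqr.
exact: restrict_supported.
Qed.

Theorem periodic_resolution n : (forall i, (deg i <= n)%N) ->
  exists M : resolution A,
    [/\ finite_type M, free_resolution M, two_periodic_from n M &
        forall j, (n <= j)%N -> is_free_of_rank #|layer j| (M j)].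
Proof.
move=> deg_le; pose T j : lmodType S := 'rV[S]_#|layer j|.
pose d j : {linear T j.+1 -> T j} := periodic_map (layer j.+1) (layer j).
exists (@Resolution S A T d eps eps_surj periodic_exact0 periodic_exactS); split.
- by move=> j; exact: row_finitely_generated.
- by move=> j; exact: row_is_free.
(* Terms and maps are functions of the layers as sets, so equal layers give equal modules and equal
   arrows. *)
- split=> j le_j; rewrite /= /T /d (layer_periodic deg_le le_j) //.
  by rewrite (layer_periodic deg_le (leqW le_j)).
- by move=> j _; exact: row_free_of_rank.
Qed.

End PeriodicComplex.

(** * The group ring of a cyclic central quotient *)

Section GroupRingMap.
Local Open Scope ring_scope.
Variables (G K : groupType) (f : G -> K).
Hypothesis f1 : f 1%g = 1%g.
Hypothesis fM : forall x y, f (x * y)%g = (f x * f y)%g.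

Lemma group_ring_ind (P : group_ring G -> Prop) : P 0 ->
  (forall a b, P a -> P b -> P (a + b)) -> (forall c x, P << c *g x >>) ->
  forall a, P a.
Proof.
move=> P0 PD PU a.
have -> : a = \sum_(x <- msupp a) << a@_x *g x >> by exact: monalgE.
exact: (big_ind P).
Qed.

Definition group_ring_map (a : group_ring G) : group_ring K :=
  \sum_(x <- msupp a) << a@_x *g f x >>.

Lemma group_ring_mapw (d : {fset G}) a : fsubset (msupp a) d ->
  group_ring_map a = \sum_(x <- d) << a@_x *g f x >>.
Proof.
by move=> le_d; apply: big_fset_incl => // x _ /mcoeff_outdom ->; rewrite monalgU0.
Qed.

Lemma group_ring_map_is_zmod_morphism : zmod_morphism group_ring_map.
Proof.
move=> a b.
rewrite (group_ring_mapw (fsubsetUl (msupp a) (msupp b))).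
rewrite (group_ring_mapw (fsubsetUr (msupp a) (msupp b))).
rewrite (group_ring_mapw (msuppB_le _ _)) -sumrB /=.
by apply: eq_bigr => x _; rewrite mcoeffB monalgUB.
Qed.

HB.instance Definition _ :=
  GRing.isZmodMorphism.Build (group_ring G) (group_ring K) group_ring_map
    group_ring_map_is_zmod_morphism.

Lemma group_ring_map0 : group_ring_map 0 = 0.
Proof. exact: raddf0. Qed.

Lemma group_ring_mapD a b : group_ring_map (a + b) = group_ring_map a + group_ring_map b.
Proof. exact: raddfD. Qed.

Lemma group_ring_mapU c x : group_ring_map << c *g x >> = << c *g f x >>.
Proof. by rewrite (group_ring_mapw msuppU_le) big_seq_fset1 mcoeffUU. Qed.

Lemma group_ring_map_is_monoid_morphism : monoid_morphism group_ring_map.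
Proof.
split=> [|a b]; first by rewrite group_ring_mapU f1.
elim/group_ring_ind: a => [|a1 a2 IH1 IH2|c x].
- by rewrite mul0r group_ring_map0 mul0r.
- by rewrite mulrDl !group_ring_mapD mulrDl IH1 IH2.
elim/group_ring_ind: b => [|b1 b2 IH1 IH2|d y].
- by rewrite mulr0 group_ring_map0 mulr0.
- by rewrite mulrDr !group_ring_mapD mulrDr IH1 IH2.
by rewrite group_ringUU !group_ring_mapU group_ringUU fM.
Qed.

Lemma augmentation_map a : augmentation (group_ring_map a) = augmentation a.
Proof.
elim/group_ring_ind: a => [|a b IHa IHb|c x].
- by rewrite group_ring_map0 !augmentation0.
- by rewrite group_ring_mapD !augmentationD IHa IHb.
by rewrite group_ring_mapU !augmentationU.
Qed.

End GroupRingMap.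

Section CyclicQuotient.
Local Open Scope ring_scope.
Variables (G K : groupType) (f : G -> K) (r : K -> G) (z : G) (len : G -> int).
Hypothesis fM : forall x y, f (x * y)%g = (f x * f y)%g.
Hypothesis rK : cancel r f.
Hypothesis z_central : central z.
Hypothesis fz : f z = 1%g.
Hypothesis f_eq : forall x y, f x = f y -> exists a b, y = (x * (z ^+ a * (z ^+ b)^-1))%g.
Hypothesis lenM : forall x y, len (x * y)%g = len x + len y.
Hypothesis len_z : 0 < len z.

Lemma morph_group1 : f 1%g = 1%g.
Proof. by apply: (mulgI (f 1%g)); rewrite -fM !mulg1. Qed.

HB.instance Definition _ := GRing.isMonoidMorphism.Build (group_ring G) (group_ring K)
  (group_ring_map f) (group_ring_map_is_monoid_morphism morph_group1 fM).
Definition quotient_ring_map : {rmorphism group_ring G -> group_ring K} := group_ring_map f.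

Definition central_diff : group_ring G := (<< z >> : group_ring G) - 1.

Lemma quotient_ring_map_surj y : exists x, quotient_ring_map x = y.
Proof.
elim/group_ring_ind: y => [|y1 y2 [x1 <-] [x2 <-]|c k].
- by exists 0; rewrite raddf0.
- by exists (x1 + x2); rewrite raddfD.
by exists << c *g r k >>; rewrite /= group_ring_mapU rK.
Qed.

Lemma quotient_ring_map_diff : quotient_ring_map central_diff = 0.
Proof. by rewrite rmorphB rmorph1 /= group_ring_mapU fz subrr. Qed.

Lemma central_diffC a : a * central_diff = central_diff * a.
Proof.
rewrite mulrBr mulrBl mulr1 mul1r; congr (_ - _).
elim/group_ring_ind: a => [|a b IHa IHb|c x]; first by rewrite mul0r mulr0.
  by rewrite mulrDl mulrDr IHa IHb.
by rewrite !group_ringUU mulrC (centralP _ z_central).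
Qed.

Lemma mcoeff_mulU a x : ((<< z >> : group_ring G) * a)@_(z * x)%g = a@_x.
Proof.
elim/group_ring_ind: a => [|a b IHa IHb|c y]; first by rewrite mulr0 !mcoeff0.
  by rewrite mulrDr !mcoeffD IHa IHb.
by rewrite group_ringUU mul1r !mcoeffU (inj_eq (mulgI z)).
Qed.

(** If z a = a, the support of [a] is stable under z; as z has positive length, a nonempty one would
    contain elements of unbounded length. *)
Lemma central_diff_reg a : central_diff * a = 0 -> a = 0.
Proof.
rewrite mulrBl mul1r => /subr0_eq az; apply/malgP => x; rewrite mcoeff0.
apply/eqP/negPn/negP => ax.
have zx k : a@_(z ^+ k * x)%g != 0.
  elim: k => [|k IHk]; first by rewrite mul1g.
  by rewrite expgS -mulgA -az mcoeff_mulU.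
have len_zx k : len (z ^+ k * x)%g = len z *+ k + len x.
  elim: k => [|k IHk]; first by rewrite mul1g mulr0n add0r.
  by rewrite expgS -mulgA lenM IHk mulrS addrA.
pose M := (\max_(y <- msupp a) `|len y|)%N.
have le_M k : (`|len (z ^+ k * x)%g| <= M)%N.
  have xa := zx k; rewrite mcoeff_neq0 in xa.
  exact: (leq_bigmax_seq (F := fun y => `|len y|%N) (z ^+ k * x)%g xa).
have := le_M (M + `|len x| + 1)%N; rewrite len_zx -mulr_natr.
by move: len_z; nia.
Qed.

(** Modulo z - 1 every element is congruent to the lift of its image along the section [r]. The
    section is not multiplicative, but its additive extension suffices. *)
Lemma quotient_ring_map_ker a : quotient_ring_map a = 0 -> exists b, a = central_diff * b.
Proof.
pose w := central_diff.
have shift c x k : exists b,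
    (<< c *g (x * z ^+ k)%g >> : group_ring G) - << c *g x >> = w * b.
  elim: k => [|k [b IHk]]; first by exists 0; rewrite mulg1 subrr mulr0.
  exists ((<< c *g (x * z ^+ k)%g >> : group_ring G) + b); rewrite mulrDr -IHk mulrBl mul1r group_ringUU.
  by rewrite mul1r expgSr mulgA (centralP _ z_central) addrA subrK.
have same c x y : f x = f y -> exists b,
    (<< c *g y >> : group_ring G) - << c *g x >> = w * b.
  move=> /f_eq [i [j ->]]; have [b1 e1] := shift c x i.
  have [b2 e2] := shift c (x * (z ^+ i * (z ^+ j)^-1))%g j.
  rewrite mulgA mulgKV in e2; exists (b1 - b2); rewrite mulrBr -e1 -e2.
  by rewrite opprB [RHS]addrC addrA subrK mulgA.
have lift c : exists b, c - group_ring_map r (quotient_ring_map c) = w * b.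
  elim/group_ring_ind: c => [|c1 c2 [b1 e1] [b2 e2]|c x].
  - by exists 0; rewrite !(rmorph0, group_ring_map0) mulr0 subrr.
  - exists (b1 + b2); rewrite mulrDr -e1 -e2 !(rmorphD, group_ring_mapD) /= opprD !addrA.
    by rewrite [LHS](ACl (1*3*2*4)).
  - by rewrite /= !group_ring_mapU; apply: same; rewrite rK.
by move=> a0; have [b e] := lift a; exists b; rewrite -e a0 group_ring_map0 subr0.
Qed.

End CyclicQuotient.

(** * The resolution *)

Section RowAugmentation.
Local Open Scope ring_scope.
Variables (K : groupType) (d : nat).

Definition row_augmentation (v : 'rV[group_ring K]_d) : trivial_module K :=
  (\sum_k augmentation (v 0 k) : int).

Lemma row_augmentation_is_linear : linear row_augmentation.
Proof.
move=> a u v; rewrite /row_augmentation.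
transitivity (\sum_k (augmentation a * augmentation (u 0 k) + augmentation (v 0 k))).
  by apply: eq_bigr => k _; rewrite !mxE augmentationD augmentationM.
by rewrite big_split /= -mulr_sumr.
Qed.

HB.instance Definition _ := GRing.isLinear.Build (group_ring K) 'rV[group_ring K]_d
  (trivial_module K) _ row_augmentation row_augmentation_is_linear.

End RowAugmentation.

(** * The rank in the periodic range *)

Section Counting.
Variable m : nat.
Local Notation dim := (@dim m.+1).

Lemma dim_le (a : 'I_#|{set 'I_m.+1}|) : dim a <= m.+1.
Proof. by rewrite /dim -[X in _ <= X]card_ord max_card. Qed.

(** All dimensions are at most m + 1, so only the parity condition remains; toggling one vertex
    exchanges the even and the odd subsets. *)
Lemma card_layer j : m.+1 <= j -> #|layer dim j| = 2 ^ m.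
Proof.
move=> le_j; pose toggle (S : {set 'I_m.+1}) :=
  if ord0 \in S then S :\ ord0 else ord0 |: S.
have toggleK : involutive toggle.
  move=> S; rewrite {2}/toggle; have [S0|S0] := boolP (ord0 \in S).
    by rewrite /toggle !inE eqxx /= setD1K.
  by rewrite /toggle !inE eqxx /= setU1K.
have odd_toggle S : odd #|toggle S| = ~~ odd #|S|.
  rewrite /toggle; case: ifP => S0; first by rewrite (cardsD1 ord0 S) S0 /= negbK.
  by rewrite cardsU1 S0.
pose t a := enum_rank (toggle (cell a)).
have tK : involutive t by move=> a; rewrite /t /cell enum_rankK toggleK enum_valK.
have t_layer : t @: layer dim j = ~: layer dim j.
  apply/setP => a; rewrite -[a in LHS]tK (mem_imset _ _ (inv_inj tK)) in_setC !mem_layer.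
  rewrite !(leq_trans (dim_le _) le_j) /= /dim /t {1}/cell enum_rankK odd_toggle.
  by do 2!case: odd.
have := cardsC (layer dim j); rewrite -t_layer card_imset; last exact: inv_inj.
have -> : #|'I_#|{set 'I_m.+1}| | = 2 ^ m.+1.
  by rewrite card_ord -cardsT -powersetT card_powerset cardsT card_ord.
by rewrite expnS addnn -mul2n => /eqP; rewrite eqn_mul2l => /eqP.
Qed.

End Counting.

Section BraidResolution.
Local Open Scope ring_scope.
Variable m : nat.
Local Notation B := (braid m.+2).
Local Notation K := (mod_center B).
Local Notation dim := (@dim m.+1).

Lemma braid_complex : exists D : 'M[group_ring B]_#|{set 'I_m.+1}|,
  [/\ forall a b, D a b != 0 -> dim a = (dim b).+1, D *m D = 0,
      forall a, augmentation (D a (enum_rank set0)) = 0 &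
      forall p v, homogeneous dim p v -> v *m D = 0 ->
        (p = 0%N -> augmentation (v 0 (enum_rank set0)) = 0) ->
        exists2 u, homogeneous dim p.+1 u & u *m D = v].
Proof.
have lt_i (i : 'I_m.+1) : (i <= m)%N by rewrite -ltnS.
have ex_lcm (S : {set 'I_m.+1}) : exists d : B, positive d /\ forall x, positive x ->
    (forall i : 'I_m.+1, i \in S -> positive (x * (sigma m i)^-1)%g) <-> positive (x * d^-1)%g.
  by have [d pd dP] := exists_lcm S; exists d.
have [lcm lcmP] := choice ex_lcm.
(* The element clearing denominators is the full twist, while the quotient is taken below by the
   generator found in [center_cyclic]. *)
apply: (@group_complex B m (fun i => sigma m i) (@positive m) (@len m) lcm _ _ _ _ _ _ _ _ _
  (twist m)).
- exact: positive1.
- exact: positiveM.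
- exact: lenM.
- exact: positive_len_ge0.
- exact: positive_len0.
- by move=> i; rewrite len_sigma.
- move=> x px nx; case: (positive_case px) => [//|[i [y [le_i py xE]]]].
  have lt_im : (i < m.+1)%N by [].
  by exists (Ordinal lt_im); rewrite xE mulgK.
- by move=> S; case: (lcmP S).
- by move=> S x px; have [_ /(_ x px)] := lcmP S.
- move=> x; have [k pk] := exists_positive x; exists k => l le_kl.
  exact: positive_mul_twist pk.
Qed.

Lemma augmentation_reduce (pi : {rmorphism group_ring B -> group_ring K})
    (a : 'rV[group_ring B]_#|{set 'I_m.+1}|) :
  (forall x, augmentation (pi x) = augmentation x) ->
  row_augmentation (reduce pi (layer dim 0) a) =
    augmentation (a 0 (enum_rank set0)).
Proof.
move=> aug_pi; rewrite /row_augmentation.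
under eq_bigr => k _ do rewrite mxE aug_pi.
rewrite -(big_enum_val (fun i => augmentation (a 0 i))) /=.
rewrite (big_pred1 (enum_rank set0)) // => i; rewrite mem_layer leqn0 /=.
apply/andP/eqP => [[/eqP/dim0 //]|->]; by rewrite dim_i0.
Qed.

Lemma braid_resolution : exists M : resolution (trivial_module K),
  [/\ finite_type M, free_resolution M, two_periodic_from m.+1 M &
      forall j, (m.+1 <= j)%N -> is_free_of_rank (2 ^ m) (M j)].
Proof.
have [z [cz lz zP]] := center_cyclic m.
have [D [D_dim D_sqr D_aug lift]] := braid_complex.
pose f (x : B) : K := \pi_(mod_center B) x.
have fM x y : f (x * y)%g = (f x * f y)%g := esym (mod_center_mulE x y).
have fK : cancel (repr : K -> B) f by exact: reprK.
have fz : f z = 1%g by apply/eq_mod_centerP; rewrite mulg1 centralV.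
have f_eq x y : f x = f y -> exists a b, y = (x * (z ^+ a * (z ^+ b)^-1))%g.
  by move=> /eq_mod_centerP/zP [a [b e]]; exists a, b; rewrite -e mulKVg.
pose pi := quotient_ring_map fM; pose w := central_diff z.
have pi_surj := quotient_ring_map_surj fM fK.
have pi_ker := quotient_ring_map_ker (fM := fM) fK cz f_eq.
have pi_w := quotient_ring_map_diff fM fz.
have w_central := central_diffC cz.
have w_reg := central_diff_reg cz (@lenM m) lz.
have aug_pi x : augmentation (pi x) = augmentation x by exact: augmentation_map.
pose i0 : 'I_#|{set 'I_m.+1}| := enum_rank set0.
pose cyc (v : 'rV[group_ring B]_#|{set 'I_m.+1}|) := augmentation (v 0 i0) = 0.
have w_aug i : dim i = 0%N -> cyc (row i w%:M).
  move=> /dim0 ->; rewrite /cyc !mxE eqxx mulr1n /w /central_diff augmentationD augmentationN.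
  by rewrite !augmentationU subrr.
have [H [H_sqr H_supp H_lead]] := matrix_factorization D_dim D_sqr lift w_central w_aug.
have cyc_mul u : cyc (u *m D).
  by rewrite /cyc mxE augmentation_sum big1 // => i _; rewrite augmentationM D_aug mulr0.
have eps_surj k : exists x, @row_augmentation K #|layer dim 0| x = k.
  exists (reduce pi _ ((k : int)%:~R *: delta_mx 0 i0)).
  rewrite augmentation_reduce // !mxE !eqxx mulr1 -[_%:~R]mul1r.
  by rewrite augmentationMz augmentationU mul1r.
have eps_ker a : supported (layer dim 0) a ->
    @row_augmentation K #|layer dim 0| (reduce pi _ a) = 0 <-> cyc a.
  by rewrite augmentation_reduce.
have [M [fin free per rank]] := @periodic_resolution _ _ pi w pi_surj pi_ker pi_w w_central
  w_reg _ dim D H cyc D_dim lift H_sqr H_supp H_lead _ _ eps_surj eps_ker cyc_mul m.+1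
  (@dim_le m).
exists M; split=> // j le_j; rewrite -(card_layer le_j); exact: rank.
Qed.

End BraidResolution.

Theorem theorem8p20 (n : nat) (hn : (2 <= n)%N) :
  exists M : resolution (trivial_module (mod_center (braid n.+1))),
    [/\ finite_type M,
        free_resolution M,
        two_periodic_from n M &
        forall j : nat, (n <= j)%N -> is_free_of_rank (2 ^ (n - 1)) (M j)].
Proof. by case: n hn => // m _; rewrite subn1; exact: braid_resolution. Qed.
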